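(* Let $\alpha>0$ and let $\varphi:(0,\infty)\to(0,\infty)$ be the separating solution defined in the context. Let $(A(t),C(t))$, with $A(t)>0$ and $C(t)>0$, be a solution of the system $$\frac{dC}{dt}=-\frac{4C^2}{A^2}-2\alpha\frac{C^3}{A^4},\qquad \frac{dA}{dt}=8+4\frac{C}{A}-\alpha\,\frac{16A^2+24AC+10C^2}{A^3},$$ with initial data $(C(0),A(0))=(C_0,A_0)$, $C_0>0$, $A_0>0$, defined on its maximal forward interval of existence $[0,t_{\max})$. (1) If $A_0>\varphi(C_0)$, then the solution is immortal, i.e. $t_{\max}=\infty$, and $A(t)\to\infty$ and $C(t)\to\overline{C}$ as $t\to\infty$ for some constant $\overline{C}\ge0$. (2) If $A_0\le\varphi(C_0)$, then either the solution converges to $(0,0)$ in finite time (that is, $t_{\max}<\infty$ and $(C(t),A(t))\to(0,0)$ as $t\to t_{\max}$), or the solution satisfies $(C(t),A(t))\to(0,2\alpha)$ as $t\to t_{\max}$.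
   Context: The system is the second-order renormalization group (RG-2) flow $\partial_t g_{ij}=-2R_{ij}-\frac{\alpha}{2}R_{iklm}R_j{}^{klm}$, with coupling constant $\alpha>0$, restricted to homogeneous $\mathrm{SL}(2,\mathbb{R})$ metrics that are diagonal with components $(A,B,C)$ in a fixed left-invariant (Milnor) frame and satisfy the local rotational symmetry condition $A=B$. Solutions are considered in the open quarter plane $\{C>0,\,A>0\}$, and $[0,t_{\max})$, $0<t_{\max}\le\infty$, denotes the maximal interval on which the solution exists in that region. Definition of $\varphi$. For $A,C>0$ put $$f(A,C):=-\frac{A\left(4A^3+2A^2C-8\alpha A^2-12\alpha AC-5\alpha C^2\right)}{C^2(2A^2+\alpha C)}.$$ The trajectory ODE is $\frac{dA}{dC}=f(A,C)$, for positive functions $A(C)$ on subintervals of $(0,\infty)$. The zero set $\{(C,A): A,C>0,\ f(A,C)=0\}$ is the graph $A=g(C)$ of a smooth strictly increasing function $g:(0,\infty)\to(0,\infty)$. For each positive integer $n$, let $\varphi_n$ be the maximally extended solution of the trajectory ODE with $\varphi_n(1/n)=g(1/n)$; its domain contains $[1/n,\infty)$. The function $\varphi:(0,\infty)\to(0,\infty)$ is the pointwise limit $\varphi(C):=\lim_{n\to\infty}\varphi_n(C)$ (which exists for every $C>0$, and is itself a solution of the trajectory ODE). *)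

(* Defs.v *)
From Stdlib Require Import Reals.
From Coquelicot Require Import Coquelicot.
Open Scope R_scope.

(* Conventions: Stdlib real numbers with Coquelicot.  In every definition the
   metric component A comes before C, but a phase point is the pair (C, A). *)

Definition rg2_dC (alpha A C : R) : R :=
  - (4 * C ^ 2 / A ^ 2) - 2 * alpha * (C ^ 3 / A ^ 4).

Definition rg2_dA (alpha A C : R) : R :=
  8 + 4 * (C / A)
  - alpha * ((16 * A ^ 2 + 24 * A * C + 10 * C ^ 2) / A ^ 3).

Definition forward_interval (T : Rbar) (t : R) : Prop :=
  0 <= t /\ Rbar_lt (Finite t) T.

(* [D_in] is the derivative relative to a domain, hence the right derivative
   at t = 0; values of A and C outside [0, T) play no role. *)
Definition rg2_solution (alpha : R) (T : Rbar) (A C : R -> R) : Prop :=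
  forall t : R, forward_interval T t ->
    0 < A t /\ 0 < C t /\
    D_in C (fun s => rg2_dC alpha (A s) (C s)) (forward_interval T) t /\
    D_in A (fun s => rg2_dA alpha (A s) (C s)) (forward_interval T) t.

Definition rg2_maximal_solution (alpha : R) (T : Rbar) (A C : R -> R) : Prop :=
  Rbar_lt (Finite 0) T /\
  rg2_solution alpha T A C /\
  forall (T' : Rbar) (A' C' : R -> R),
    Rbar_le T T' ->
    rg2_solution alpha T' A' C' ->
    (forall t : R, forward_interval T t -> A' t = A t /\ C' t = C t) ->
    T' = T.

(* The filter "t -> T with t < T", for T finite or infinite. *)
Definition Rbar_at_left (T : Rbar) : (R -> Prop) -> Prop :=
  within (fun t : R => Rbar_lt (Finite t) T) (Rbar_locally T).

(* The quotient rg2_dA / rg2_dC in simplified form. *)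
Definition trajectory_rhs (alpha A C : R) : R :=
  - (A * (4 * A ^ 3 + 2 * A ^ 2 * C - 8 * alpha * A ^ 2
          - 12 * alpha * A * C - 5 * alpha * C ^ 2)
     / (C ^ 2 * (2 * A ^ 2 + alpha * C))).

Definition trajectory_solution
    (alpha : R) (a : R) (b : Rbar) (y : R -> R) : Prop :=
  0 <= a /\
  forall x : R, a < x -> Rbar_lt (Finite x) b ->
    0 < y x /\ is_derive y x (trajectory_rhs alpha (y x) x).

Definition trajectory_maximal_solution
    (alpha : R) (a : R) (b : Rbar) (y : R -> R) : Prop :=
  trajectory_solution alpha a b y /\
  forall (a' : R) (b' : Rbar) (y' : R -> R),
    a' <= a -> Rbar_le b b' ->
    trajectory_solution alpha a' b' y' ->
    (forall x : R, a < x -> Rbar_lt (Finite x) b -> y' x = y x) ->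
    a' = a /\ b' = b.

Definition trajectory_nullcline (alpha : R) (g : R -> R) : Prop :=
  forall C : R, 0 < C ->
    0 < g C /\
    forall A : R, 0 < A -> (trajectory_rhs alpha A C = 0 <-> A = g C).

Definition nullcline_trajectory
    (alpha : R) (g : R -> R) (n : nat) (y : R -> R) : Prop :=
  exists (a : R) (b : Rbar),
    a < / INR n /\ Rbar_lt (Finite (/ INR n)) b /\
    trajectory_maximal_solution alpha a b y /\
    y (/ INR n) = g (/ INR n).

(* [phin n] is unconstrained outside the domain of the n-th maximal solution.
   This does not affect the limit at C > 0: that domain contains [1/n, oo),
   hence C as soon as 1/n <= C. *)
Definition separating_solution (alpha : R) (phi : R -> R) : Prop :=
  exists (g : R -> R) (phin : nat -> R -> R),
    trajectory_nullcline alpha g /\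
    (forall n : nat, (1 <= n)%nat -> nullcline_trajectory alpha g n (phin n)) /\
    forall C : R, 0 < C ->
      is_lim_seq (fun n => phin n C) (Finite (phi C)).

(* Main.v *)
Require Import Defs.
From Stdlib Require Import Reals Lra Lia.
From Coquelicot Require Import Coquelicot.
Open Scope R_scope.

(** The whole argument turns on the cubic
    P(A,C) = 4A^3 + 2A^2 C - 8 alpha A^2 - 12 alpha A C - 5 alpha C^2,
    whose sign is the sign of dA/dt and whose zero set is the nullcline.  For
    A > 0 it equals A^2 times a function of A and the ratio C/A, and this
    factor shows that the region P > 0 is stable under increasing A and under
    decreasing C ([cubic_positive_mono], [cubic_positive_above_root]).  Since
    C always decreases in time, and A increases where P > 0, the region P > 0
    is forward invariant ([positive_cubic_persists]); read with C as time, the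
    same fact says that a trajectory starting on the nullcline stays below it
    for larger C.  Hence phi_n is nondecreasing on [1/n, oo), it is trapped
    under the nullcline, it exists there globally because a bounded solution
    can be continued ([nullcline_trajectory_global]), and the phi_n decrease
    with n, so that phi <= phi_n ([separating_solution_below]).

    An orbit of the system is a trajectory parametrized by t, so it cannot
    cross any phi_n ([flow_trajectory_noncrossing]).

    Above phi: the orbit starts above some phi_n, and then A stays above
    m = g(1/n) > 2 alpha.  Indeed it stays above phi_n >= m while C >= 1/n,
    and if C reaches 1/n the orbit is in the region P > 0, where A increases.
    With A >= m, both the growth of A and the growth of 1/C are at most linear
    in t, so the orbit remains in compact sets for finite times and is
    immortal.  It cannot remain bounded: A <= M forces C -> 0, after which
    dA/dt exceeds a positive constant ([no_bounded_immortal_flow]).  Therefore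
    P > 0 at some time, A increases from then on, and A -> oo.

    Below phi: the orbit is below every phi_n with 1/n <= C, so P <= 0 for all
    time, and A and C decrease to limits a and c.  If c > 0, then
    ln A - K C is nondecreasing for some K, so A stays away from 0
    ([flow_A_positive_of_C_positive]); the orbit remains in a compact set, so it
    is immortal, but then dC/dt is bounded away from 0, which is absurd.  So
    c = 0, and passing to the limit in P <= 0 gives a <= 2 alpha.  If
    a < 2 alpha, then dA/dt is eventually below a negative constant and the
    maximal time is finite; if moreover a > 0, then 1/C grows at most linearly
    and cannot blow up in finite time, so a = 0.

    Continuation of solutions rests on the Picard-Lindelof theorem for planar
    autonomous systems ([picard_lindelof], [ode_extension]), applied both to
    the system and to the trajectory equation with C' = 1 adjoined. *)

(** * Mean values, sign propagation and monotone limits *)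
Lemma mean_value_lower (f : R -> R) (a b k : R) :
  a <= b ->
  (forall x, a <= x <= b -> continuous f x) ->
  (forall x, a < x < b -> exists d, is_derive f x d /\ k <= d) ->
  k * (b - a) <= f b - f a.
Proof.
  intros [Hab | ->] Hc Hd; [| lra].
  assert (Hdf : forall c, a < c < b -> derivable_pt f c).
  { intros c Hc'; apply ex_derive_Reals_0.
    destruct (Hd c Hc') as [d [Hf _]]; now exists d. }
  destruct (MVT f id a b Hdf (fun c _ => derivable_pt_id c)) as [c [Hcab E]].
  - exact Hab.
  - intros c Hc'; apply continuity_pt_filterlim, Hc, Hc'.
  - intros c _; apply derivable_continuous_pt, derivable_pt_id.
  - destruct (Hd c Hcab) as [d [Hf Hk]].
    rewrite derive_pt_id in E.
    assert (Ed : derive_pt f c (Hdf c Hcab) = d).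
    { apply derive_pt_eq_0; now apply is_derive_Reals. }
    rewrite Ed in E; unfold id in E; nra.
Qed.

Lemma mean_value_upper (f : R -> R) (a b k : R) :
  a <= b ->
  (forall x, a <= x <= b -> continuous f x) ->
  (forall x, a < x < b -> exists d, is_derive f x d /\ d <= k) ->
  f b - f a <= k * (b - a).
Proof.
  intros Hab Hc Hd.
  enough (- k * (b - a) <= - f b - - f a) by lra.
  apply (mean_value_lower (fun x => - f x)); [exact Hab | |].
  - intros x Hx; apply (continuous_opp f), Hc, Hx.
  - intros x Hx; destruct (Hd x Hx) as [d [H1 H2]].
    exists (- d); split; [exact (is_derive_opp f x d H1) | lra].
Qed.

Lemma intermediate_zero (f : R -> R) (a b : R) :
  a <= b ->
  (forall x, a <= x <= b -> continuous f x) ->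
  f a * f b <= 0 -> exists z, a <= z <= b /\ f z = 0.
Proof.
  intros [Hab | ->] Hc Hs; [| exists b; split; [lra | nra]].
  destruct (Req_dec (f a) 0) as [Ea | Ea]; [exists a; split; [lra | easy] |].
  destruct (Req_dec (f b) 0) as [Eb | Eb]; [exists b; split; [lra | easy] |].
  destruct (Rlt_dec (f a) 0) as [La | La].
  - destruct (Ranalysis5.IVT_interv f a b) as [z Hz]; [| easy | easy | nra |].
    + intros x Hx; apply continuity_pt_filterlim, Hc, Hx.
    + now exists z.
  - destruct (Ranalysis5.IVT_interv (fun x => - f x) a b) as [z Hz];
      [| easy | nra | nra |].
    + intros x Hx; apply continuity_pt_filterlim, (continuous_opp f), Hc, Hx.
    + exists z; split; [easy | lra].
Qed.

Lemma continuous_positive_near (f : R -> R) (x : R) :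
  continuous f x -> 0 < f x ->
  exists d, 0 < d /\ forall y, Rabs (y - x) < d -> 0 < f y.
Proof.
  intros Hc Hp.
  destruct (Hc (fun y => 0 < y)) as [d Hd].
  - exists (mkposreal _ Hp); intros y Hy.
    apply Rabs_lt_between in Hy; simpl in Hy.
    unfold minus, plus, opp in Hy; simpl in Hy; lra.
  - exists d; split; [apply cond_pos | exact Hd].
Qed.

(** Real induction: the supremum of the times up to which [h] is positive is
    itself such a time by hypothesis, and continuity moves past it unless it
    is [b]. *)
Lemma positive_propagates (h : R -> R) (a b : R) :
  a <= b ->
  (forall x, a <= x <= b -> continuous h x) ->
  0 < h a ->
  (forall s, a < s <= b -> (forall r, a <= r < s -> 0 < h r) -> 0 < h s) ->
  forall x, a <= x <= b -> 0 < h x.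
Proof.
  intros Hab Hc Ha Hstep.
  set (E := fun t => a <= t <= b /\ forall r, a <= r <= t -> 0 < h r).
  assert (Ea : E a).
  { split; [lra |]; intros r Hr; now replace r with a by lra. }
  destruct (completeness E) as [s [Hub Hlub]].
  - exists b; intros t [Ht _]; lra.
  - now exists a.
  - assert (Has : a <= s) by now apply Hub.
    assert (Hsb : s <= b) by (apply Hlub; intros t [Ht _]; lra).
    assert (Hbelow : forall r, a <= r < s -> 0 < h r).
    { intros r Hr.
      destruct (Rlt_dec 0 (h r)) as [? | Hn]; [easy |].
      enough (s <= r) by lra.
      apply Hlub; intros t [Ht Hall].
      destruct (Rle_dec t r) as [? | Htr]; [easy |].
      exfalso; apply Hn, Hall; lra. }
    assert (Hs : 0 < h s).
    { destruct Has as [Has | <-]; [apply Hstep; [lra | easy] | easy]. }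
    assert (Es : s = b).
    { destruct (Rle_lt_or_eq_dec s b Hsb) as [Hlt | ->]; [| easy].
      destruct (continuous_positive_near h s) as [d [Hd Hnear]];
        [apply Hc; lra | easy |].
      set (t := s + Rmin (d / 2) (b - s)).
      assert (Ht : s < t /\ t <= b /\ t < s + d).
      { unfold t; pose proof (Rmin_l (d / 2) (b - s));
        pose proof (Rmin_r (d / 2) (b - s)).
        assert (0 < Rmin (d / 2) (b - s)) by (apply Rmin_pos; lra); lra. }
      enough (t <= s) by lra.
      apply Hub; split; [lra |]; intros r Hr.
      destruct (Rlt_dec r s); [apply Hbelow; lra |].
      apply Hnear, Rabs_lt_between; lra. }
    intros x Hx; destruct (Req_dec x s) as [-> | Hne]; [easy | apply Hbelow; lra].
Qed.

Lemma continuous_positive_bounds (h : R -> R) (a b : R) :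
  a <= b ->
  (forall x, a <= x <= b -> continuous h x) ->
  (forall x, a <= x <= b -> 0 < h x) ->
  exists m M, 0 < m /\ forall x, a <= x <= b -> m <= h x <= M.
Proof.
  intros Hab Hc Hp.
  assert (Hc' : forall x, a <= x <= b -> continuity_pt h x).
  { intros x Hx; apply continuity_pt_filterlim, Hc, Hx. }
  destruct (continuity_ab_min h a b Hab Hc') as [u [Hu Iu]].
  destruct (continuity_ab_maj h a b Hab Hc') as [v [Hv _]].
  exists (h u), (h v); split; [now apply Hp |].
  intros x Hx; split; [now apply Hu | now apply Hv].
Qed.

(** D^2 exp(-2Kx) is nonincreasing and D^2 exp(2Kx) is nondecreasing, so a
    zero of [D] propagates in both directions. *)
Lemma gronwall_zero (D : R -> R) (a b K : R) :
  a <= b ->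
  (forall x, a <= x <= b -> continuous D x) ->
  (forall x, a < x < b -> exists d, is_derive D x d /\ Rabs d <= K * Rabs (D x)) ->
  (D a = 0 <-> D b = 0).
Proof.
  intros Hab Hc Hd.
  assert (Hexp : forall k x, a <= x <= b ->
      continuous (fun x => D x * D x * exp (k * x)) x).
  { intros k x Hx; apply (continuous_mult (fun x => D x * D x)).
    - now apply (continuous_mult D D); apply Hc.
    - apply (ex_derive_continuous (fun x => exp (k * x))); auto_derive; easy. }
  assert (Hder : forall k x, a < x < b -> exists d,
      is_derive (fun x => D x * D x * exp (k * x)) x
        ((2 * d * D x + k * (D x * D x)) * exp (k * x)) /\
      Rabs (d * D x) <= K * (D x * D x)).
  { intros k x Hx; destruct (Hd x Hx) as [d [H1 H2]]; exists d; split.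
    - auto_derive.
      + now repeat split; exists d.
      + replace (Derive (fun x : R => D x) x) with d
          by (symmetry; now apply is_derive_unique); ring.
    - rewrite Rabs_mult, <- (Rabs_pos_eq (D x * D x)), Rabs_mult by nra.
      pose proof (Rabs_pos (D x)); nra. }
  split; intro E0.
  - assert (H : D b * D b * exp (-2 * K * b) - D a * D a * exp (-2 * K * a)
                <= 0 * (b - a)).
    { apply (mean_value_upper (fun x => D x * D x * exp (-2 * K * x)));
        [easy | apply Hexp |].
      intros x Hx; destruct (Hder (-2 * K) x Hx) as [d [H1 H2]].
      eexists; split; [exact H1 |].
      apply Rabs_le_between in H2; pose proof (exp_pos (-2 * K * x)).
      assert (2 * d * D x + -2 * K * (D x * D x) <= 0) by lra; nra. }
    rewrite E0 in H; pose proof (exp_pos (-2 * K * b)).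
    assert (D b * D b <= 0) by nra; nra.
  - assert (H : 0 * (b - a) <=
                D b * D b * exp (2 * K * b) - D a * D a * exp (2 * K * a)).
    { apply (mean_value_lower (fun x => D x * D x * exp (2 * K * x)));
        [easy | apply Hexp |].
      intros x Hx; destruct (Hder (2 * K) x Hx) as [d [H1 H2]].
      eexists; split; [exact H1 |].
      apply Rabs_le_between in H2; pose proof (exp_pos (2 * K * x)).
      assert (0 <= 2 * d * D x + 2 * K * (D x * D x)) by lra; nra. }
    rewrite E0 in H; pose proof (exp_pos (2 * K * a)).
    assert (D a * D a <= 0) by nra; nra.
Qed.

(** A change of sign would produce a zero of [D] inside the interval, and
    then [D] would vanish at both ends. *)
Lemma gronwall_sign (D : R -> R) (a b K : R) :
  a <= b ->
  (forall x, a <= x <= b -> continuous D x) ->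
  (forall x, a < x < b -> exists d, is_derive D x d /\ Rabs d <= K * Rabs (D x)) ->
  (0 < D a <-> 0 < D b).
Proof.
  intros Hab Hc Hd.
  assert (Hz : D a * D b <= 0 -> D a = 0 /\ D b = 0).
  { intros Hs; destruct (intermediate_zero D a b Hab Hc Hs) as [z [Hz Ez]].
    split.
    - apply (gronwall_zero D a z K); [lra | | | easy]; intros; [apply Hc | apply Hd]; lra.
    - apply (gronwall_zero D z b K); [lra | | | easy]; intros; [apply Hc | apply Hd]; lra. }
  split; intros H.
  - destruct (Rlt_dec 0 (D b)); [easy |]; destruct Hz; nra.
  - destruct (Rlt_dec 0 (D a)); [easy |]; destruct Hz; nra.
Qed.

(** Needed where two solutions are joined: there only the continuity of the
    joined function and the limit of its derivative are known. *)
Lemma is_derive_removable (f : R -> R) (x l r : R) :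
  0 < r ->
  (forall y, Rabs (y - x) < r -> continuous f y) ->
  (forall e, 0 < e -> exists d, 0 < d /\ forall y, y <> x -> Rabs (y - x) < d ->
      exists f', is_derive f y f' /\ Rabs (f' - l) <= e) ->
  is_derive f x l.
Proof.
  intros Hr Hc Hd; apply is_derive_Reals; intros e He.
  destruct (Hd (e / 2)) as [d [Hd0 Hd1]]; [lra |].
  assert (Hm : 0 < Rmin d r) by now apply Rmin_pos.
  exists (mkposreal _ Hm); simpl; intros h Hh Hhm.
  pose proof (Rmin_l d r); pose proof (Rmin_r d r).
  apply Rabs_lt_between in Hhm.
  assert (Hincr : forall u v, u <= v -> x - Rmin d r < u -> v < x + Rmin d r ->
      ~ u < x < v ->
      (l - e / 2) * (v - u) <= f v - f u <= (l + e / 2) * (v - u)).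
  { intros u v Huv Hu Hv Hx.
    split; [apply mean_value_lower | apply mean_value_upper]; try easy;
      try (intros y Hy; apply Hc, Rabs_lt_between; lra);
      intros y Hy; destruct (Hd1 y) as [f' [H1 H2]];
      try (apply Rabs_lt_between; lra);
      try (intros ->; now apply Hx);
      exists f'; split; try easy; apply Rabs_le_between in H2; lra. }
  set (q := (f (x + h) - f x) / h).
  assert (Eq : f (x + h) - f x = q * h) by (unfold q; field; easy).
  apply Rabs_lt_between.
  destruct (Rlt_dec 0 h) as [Hp | Hp].
  - destruct (Hincr x (x + h)); try lra; split; nra.
  - destruct (Hincr (x + h) x); try lra; split; nra.
Qed.

(** Convergence as t increases to [T], finite or infinite, of functions that
    matter only on [0, T). *)
Definition tends_left (T : Rbar) (f : R -> R) (l : R) : Prop :=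
  forall e, 0 < e -> exists t0, 0 <= t0 /\ Rbar_lt t0 T /\
    forall t, t0 <= t -> Rbar_lt t T -> Rabs (f t - l) < e.

Lemma antitone_limit (T : Rbar) (f : R -> R) :
  Rbar_lt 0 T ->
  (forall s t, 0 <= s -> s <= t -> Rbar_lt t T -> f t <= f s) ->
  (forall t, 0 <= t -> Rbar_lt t T -> 0 <= f t) ->
  exists l, 0 <= l /\ (forall t, 0 <= t -> Rbar_lt t T -> l <= f t) /\ tends_left T f l.
Proof.
  intros HT Hm Hp.
  set (E := fun z => exists t, 0 <= t /\ Rbar_lt t T /\ z = - f t).
  destruct (completeness E) as [s [Hub Hlub]].
  - exists 0; intros z [t [H1 [H2 ->]]]; specialize (Hp t H1 H2); lra.
  - exists (- f 0), 0; repeat split; [lra | easy].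
  - assert (Hle : forall t, 0 <= t -> Rbar_lt t T -> - s <= f t).
    { intros t H1 H2; enough (- f t <= s) by lra; apply Hub; now exists t. }
    exists (- s); split; [| split; [easy |]].
    + enough (s <= 0) by lra; apply Hlub.
      intros z [t [H1 [H2 ->]]]; specialize (Hp t H1 H2); lra.
    + intros e He.
      destruct (Classical_Prop.classic
        (exists t0, 0 <= t0 /\ Rbar_lt t0 T /\ f t0 < - s + e)) as [[t0 [H1 [H2 H3]]] | Hn].
      * exists t0; split; [easy | split; [easy |]]; intros t H4 H5.
        specialize (Hm t0 t H1 H4 H5); specialize (Hle t ltac:(lra) H5).
        apply Rabs_lt_between; lra.
      * exfalso; enough (s <= s - e) by lra; apply Hlub.
        intros z [t [H1 [H2 ->]]].
        destruct (Rlt_dec (f t) (- s + e)); [| lra].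
        exfalso; apply Hn; now exists t.
Qed.

(** * The Picard-Lindelof theorem for planar autonomous systems *)
Definition lipschitz (M : R) (u : R -> R) : Prop :=
  forall s t, Rabs (u t - u s) <= M * Rabs (t - s).

(** The bound [M] controls the speed of solutions, and the constant [L] the
    contraction of the Picard operator. *)
Definition bounded_lipschitz2 (D : R -> R -> Prop) (M L : R) (F : R -> R -> R) : Prop :=
  forall x y, D x y -> Rabs (F x y) <= M /\
    forall x' y', D x' y' ->
      Rabs (F x y - F x' y') <= L * (Rabs (x - x') + Rabs (y - y')).

Definition everywhere (_ _ : R) : Prop := True.

Lemma lipschitz_continuous (M : R) (u : R -> R) (t : R) :
  lipschitz M u -> continuous u t.
Proof.
  intros Hu; apply continuity_pt_filterlim; intros e He.
  pose proof (Rabs_pos M).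
  exists (e / (Rabs M + 1)); split; [apply Rdiv_lt_0_compat; lra |].
  intros s [_ Hs]; simpl in Hs |- *; unfold R_dist in *.
  eapply Rle_lt_trans; [apply Hu |].
  apply Rle_lt_trans with (Rabs M * Rabs (s - t)).
  - apply Rmult_le_compat_r; [apply Rabs_pos | apply Rle_abs].
  - apply (Rmult_lt_compat_l (Rabs M + 1)) in Hs; [| lra].
    replace ((Rabs M + 1) * (e / (Rabs M + 1))) with e in Hs by (field; lra).
    pose proof (Rabs_pos (s - t)); nra.
Qed.

Definition clamp (p q x : R) : R := Rmax p (Rmin q x).

Lemma clamp_range (p q x : R) : p <= q -> p <= clamp p q x <= q.
Proof.
  intros H; unfold clamp, Rmax, Rmin.
  destruct (Rle_dec q x), (Rle_dec p q), (Rle_dec p x); lra.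
Qed.

Lemma clamp_id (p q x : R) : p <= x <= q -> clamp p q x = x.
Proof.
  intros H; unfold clamp, Rmax, Rmin.
  destruct (Rle_dec q x), (Rle_dec p q), (Rle_dec p x); lra.
Qed.

Lemma clamp_lipschitz (p q : R) : p <= q -> lipschitz 1 (clamp p q).
Proof.
  intros H s t; unfold clamp, Rmax, Rmin.
  destruct (Rle_dec q s), (Rle_dec q t), (Rle_dec p q), (Rle_dec p s), (Rle_dec p t);
    split_Rabs; lra.
Qed.

Definition picard_step (G : R -> R -> R) (x : R) (u v : R -> R) : R -> R :=
  fun t => x + RInt (fun s => G (u s) (v s)) 0 t.

Fixpoint picard (G H : R -> R -> R) (x y : R) (n : nat) : (R -> R) * (R -> R) :=
  match n with
  | O => (fun _ => x, fun _ => y)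
  | S n => let (u, v) := picard G H x y n in
           (picard_step G x u v, picard_step H y u v)
  end.

Lemma lipschitz_field_along (G : R -> R -> R) (M K L : R) (u v : R -> R) :
  0 <= L -> bounded_lipschitz2 everywhere M L G ->
  lipschitz K u -> lipschitz K v ->
  lipschitz (L * (K + K)) (fun s => G (u s) (v s)).
Proof.
  intros HL HG Hu Hv s t.
  destruct (HG (u t) (v t) I) as [_ H].
  specialize (H (u s) (v s) I); specialize (Hu s t); specialize (Hv s t).
  eapply Rle_trans; [exact H |].
  rewrite Rmult_assoc; apply Rmult_le_compat_l; lra.
Qed.

Lemma ex_RInt_lipschitz (K : R) (g : R -> R) (a b : R) :
  lipschitz K g -> ex_RInt g a b.
Proof.
  intros Hg; apply (ex_RInt_continuous (V := R_CompleteNormedModule)).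
  intros z _; now apply lipschitz_continuous with K.
Qed.

Lemma RInt_abs_le (g : R -> R) (a b M : R) :
  ex_RInt g a b ->
  (forall x, Rmin a b <= x <= Rmax a b -> Rabs (g x) <= M) ->
  Rabs (RInt g a b) <= Rabs (b - a) * M.
Proof.
  intros Hex Hg.
  apply (norm_RInt_le_const_abs (V := R_NormedModule) g a b (RInt g a b) M Hg).
  now apply (RInt_correct (V := R_CompleteNormedModule)).
Qed.

Lemma picard_step_lipschitz (G : R -> R -> R) (M K L x : R) (u v : R -> R) :
  0 <= L -> bounded_lipschitz2 everywhere M L G ->
  lipschitz K u -> lipschitz K v -> lipschitz M (picard_step G x u v).
Proof.
  intros HL HG Hu Hv s t.
  pose proof (lipschitz_field_along G M K L u v HL HG Hu Hv) as Hg.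
  set (g := fun s => G (u s) (v s)) in *.
  replace (picard_step G x u v t - picard_step G x u v s) with (RInt g s t).
  - rewrite Rmult_comm; apply RInt_abs_le.
    + now apply ex_RInt_lipschitz with (L * (K + K)).
    + intros r _; now apply HG.
  - unfold picard_step; fold g.
    assert (E : RInt g 0 s + RInt g s t = RInt g 0 t).
    { apply (RInt_Chasles (V := R_CompleteNormedModule));
        now apply ex_RInt_lipschitz with (L * (K + K)). }
    lra.
Qed.

Lemma picard_step_contracts (G : R -> R -> R) (M K L x d e : R) (u v u' v' : R -> R) :
  0 <= L -> bounded_lipschitz2 everywhere M L G ->
  lipschitz K u -> lipschitz K v -> lipschitz K u' -> lipschitz K v' ->
  (forall s, Rabs s <= d -> Rabs (u s - u' s) + Rabs (v s - v' s) <= e) ->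
  forall t, Rabs t <= d ->
    Rabs (picard_step G x u v t - picard_step G x u' v' t) <= d * (L * e).
Proof.
  intros HL HG Hu Hv Hu' Hv' He t Ht.
  pose proof (lipschitz_field_along G M K L u v HL HG Hu Hv) as Hg.
  pose proof (lipschitz_field_along G M K L u' v' HL HG Hu' Hv') as Hg'.
  set (g := fun s => G (u s) (v s)) in *.
  set (g' := fun s => G (u' s) (v' s)) in *.
  replace (picard_step G x u v t - picard_step G x u' v' t)
    with (RInt (fun s => g s - g' s) 0 t).
  - eapply Rle_trans.
    + apply RInt_abs_le with (M := L * e).
      * apply (ex_RInt_minus (V := R_NormedModule) g g');
          now apply ex_RInt_lipschitz with (L * (K + K)).
      * intros s Hs.
        assert (Hsd : Rabs s <= d).
        { revert Hs Ht; unfold Rmin, Rmax; destruct (Rle_dec 0 t);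
            unfold Rabs; destruct (Rcase_abs t), (Rcase_abs s); lra. }
        destruct (HG (u s) (v s) I) as [_ H].
        eapply Rle_trans; [exact (H (u' s) (v' s) I) |].
        apply Rmult_le_compat_l; [easy | now apply He].
    + rewrite Rminus_0_r; apply Rmult_le_compat_r; [| easy].
      apply Rmult_le_pos; [easy |].
      specialize (He t Ht).
      pose proof (Rabs_pos (u t - u' t)); pose proof (Rabs_pos (v t - v' t)); lra.
  - unfold picard_step; fold g g'.
    assert (E : RInt (fun s => g s - g' s) 0 t = RInt g 0 t - RInt g' 0 t).
    { apply (RInt_minus (V := R_CompleteNormedModule));
        now apply ex_RInt_lipschitz with (L * (K + K)). }
    lra.
Qed.

Lemma picard_step_derive (G : R -> R -> R) (M K L x : R) (u v : R -> R) (t : R) :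
  0 <= L -> bounded_lipschitz2 everywhere M L G ->
  lipschitz K u -> lipschitz K v ->
  is_derive (picard_step G x u v) t (G (u t) (v t)).
Proof.
  intros HL HG Hu Hv.
  pose proof (lipschitz_field_along G M K L u v HL HG Hu Hv) as Hg.
  set (g := fun s => G (u s) (v s)) in *.
  change (G (u t) (v t)) with (g t).
  replace (g t) with (plus zero (g t)) by apply plus_zero_l.
  apply (is_derive_plus (fun _ => x) (fun t => RInt g 0 t)).
  - apply (is_derive_const x t).
  - apply (is_derive_RInt g (fun t => RInt g 0 t) 0 t).
    + apply filter_forall; intros s.
      apply (RInt_correct (V := R_CompleteNormedModule)).
      now apply ex_RInt_lipschitz with (L * (K + K)).
    + now apply lipschitz_continuous with (L * (K + K)).
Qed.

Lemma is_lim_seq_abs_le (w : nat -> R) (l c r : R) (N : nat) :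
  is_lim_seq w l -> (forall n, (N <= n)%nat -> Rabs (w n - c) <= r) -> Rabs (l - c) <= r.
Proof.
  intros Hl Hw.
  apply (is_lim_seq_le_loc (fun n => Rabs (w n - c)) (fun _ => r)
           (Rabs (l - c)) r).
  - now exists N.
  - apply (is_lim_seq_abs (fun n => w n - c) (l - c)).
    apply (is_lim_seq_minus' w (fun _ => c) l c Hl), is_lim_seq_const.
  - apply is_lim_seq_const.
Qed.

(** The field is globally bounded and Lipschitz, so the Picard iterates are
    defined on the whole line and are all [M]-Lipschitz; on a short interval
    they converge uniformly, and their limit is a fixed point of the integral
    operator. *)
Lemma picard_lindelof (G H : R -> R -> R) (M L x y : R) :
  0 <= M -> 0 <= L ->
  bounded_lipschitz2 everywhere M L G -> bounded_lipschitz2 everywhere M L H ->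
  exists d u v, 0 < d /\ u 0 = x /\ v 0 = y /\ lipschitz M u /\ lipschitz M v /\
    forall t, Rabs t < d ->
      is_derive u t (G (u t) (v t)) /\ is_derive v t (H (u t) (v t)).
Proof.
  intros HM HL HG HH.
  set (U := fun n => fst (picard G H x y n)).
  set (V := fun n => snd (picard G H x y n)).
  assert (US : forall n, U (S n) = picard_step G x (U n) (V n)).
  { intros n; unfold U, V; simpl; now destruct (picard G H x y n). }
  assert (VS : forall n, V (S n) = picard_step H y (U n) (V n)).
  { intros n; unfold U, V; simpl; now destruct (picard G H x y n). }
  assert (Hlip : forall n, lipschitz M (U n) /\ lipschitz M (V n)).
  { induction n as [| n [IHu IHv]].
    - split; intros s t; simpl; unfold Rminus; rewrite Rplus_opp_r, Rabs_R0;
        apply Rmult_le_pos; try easy; apply Rabs_pos.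
    - rewrite US, VS; split; now apply picard_step_lipschitz with M L. }
  assert (Hini : forall n, U n 0 = x /\ V n 0 = y).
  { intros [| n]; [easy |]; rewrite US, VS; unfold picard_step.
    rewrite !RInt_point; unfold zero; simpl; lra. }
  (* on [-d, d] one step divides the sum of the two sup distances by 2 *)
  set (d := / (4 * (L + 1))).
  assert (Hd : 0 < d) by (apply Rinv_0_lt_compat; lra).
  assert (HLd : d * L <= / 4).
  { unfold d; apply Rmult_le_reg_l with (4 * (L + 1)); [lra |].
    rewrite <- Rmult_assoc, Rinv_r by lra; lra. }
  set (B := 2 * M * d).
  assert (HB : 0 <= B) by (unfold B; nra).
  assert (Hstep : forall n t, Rabs t <= d ->
      Rabs (U n t - U (S n) t) + Rabs (V n t - V (S n) t) <= B * (/ 2) ^ n).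
  { induction n as [| n IH]; intros t Ht.
    - assert (H0 : forall w, lipschitz M w -> Rabs (w 0 - w t) <= M * d).
      { intros w Hw; eapply Rle_trans; [apply Hw |].
        apply Rmult_le_compat_l; [easy |].
        replace (0 - t) with (- t) by ring; now rewrite Rabs_Ropp. }
      pose proof (H0 _ (proj1 (Hlip 1%nat))) as H1.
      pose proof (H0 _ (proj2 (Hlip 1%nat))) as H2.
      rewrite (proj1 (Hini 1%nat)) in H1; rewrite (proj2 (Hini 1%nat)) in H2.
      change (U 0%nat t) with x; change (V 0%nat t) with y.
      unfold B; simpl; lra.
    - rewrite (US (S n)), (VS (S n)).
      assert (K : forall W, W = picard_step G x \/ W = picard_step H y ->
          Rabs (W (U n) (V n) t - W (U (S n)) (V (S n)) t)
          <= d * (L * (B * (/ 2) ^ n))).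
      { intros W [-> | ->].
        - apply (picard_step_contracts G M M L); try easy; try apply Hlip.
        - apply (picard_step_contracts H M M L); try easy; try apply Hlip. }
      pose proof (K _ (or_introl eq_refl)) as K1.
      pose proof (K _ (or_intror eq_refl)) as K2.
      rewrite <- US in K1; rewrite <- VS in K2.
      assert (0 <= B * (/ 2) ^ n) by (apply Rmult_le_pos, pow_le; lra).
      simpl pow; nra. }
  assert (Htail : forall t, Rabs t <= d -> forall n k,
      Rabs (U (n + k)%nat t - U n t) + Rabs (V (n + k)%nat t - V n t)
      <= 2 * B * ((/ 2) ^ n - (/ 2) ^ (n + k))).
  { intros t Ht n; induction k as [| k IH].
    - rewrite Nat.add_0_r; unfold Rminus; rewrite !Rplus_opp_r, Rabs_R0; lra.
    - rewrite Nat.add_succ_r.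
      pose proof (Hstep (n + k)%nat t Ht) as Hs.
      rewrite (Rabs_minus_sym (U (n + k)%nat t)), (Rabs_minus_sym (V (n + k)%nat t)) in Hs.
      pose proof (Rabs_triang (U (S (n + k)) t - U (n + k)%nat t) (U (n + k)%nat t - U n t)).
      pose proof (Rabs_triang (V (S (n + k)) t - V (n + k)%nat t) (V (n + k)%nat t - V n t)).
      replace (U (S (n + k)) t - U n t)
        with (U (S (n + k)) t - U (n + k)%nat t + (U (n + k)%nat t - U n t)) by ring.
      replace (V (S (n + k)) t - V n t)
        with (V (S (n + k)) t - V (n + k)%nat t + (V (n + k)%nat t - V n t)) by ring.
      simpl pow; lra. }
  assert (Hunif : forall t, Rabs t <= d -> forall n m, (n <= m)%nat ->
      Rabs (U m t - U n t) + Rabs (V m t - V n t) <= 2 * B * (/ 2) ^ n).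
  { intros t Ht n m Hnm; replace m with (n + (m - n))%nat by lia.
    pose proof (Htail t Ht n (m - n)%nat).
    assert (0 <= (/ 2) ^ (n + (m - n))) by (apply pow_le; lra); nra. }
  assert (Hsmall : forall e, 0 < e -> exists n, 2 * B * (/ 2) ^ n < e).
  { intros e He; destruct (pow_lt_1_zero (/ 2)) with (y := e / (2 * B + 1)) as [n Hn].
    - rewrite Rabs_pos_eq; lra.
    - apply Rdiv_lt_0_compat; lra.
    - exists n; specialize (Hn n (Nat.le_refl n)).
      assert (0 < (/ 2) ^ n) by (apply pow_lt; lra).
      rewrite Rabs_pos_eq in Hn by lra.
      apply (Rmult_lt_compat_l (2 * B + 1)) in Hn; [| lra].
      replace ((2 * B + 1) * (e / (2 * B + 1))) with e in Hn by (field; lra); lra. }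
  assert (Hcv : forall t, Rabs t <= d ->
      is_lim_seq (fun n => U n t) (real (Lim_seq (fun n => U n t))) /\
      is_lim_seq (fun n => V n t) (real (Lim_seq (fun n => V n t)))).
  { intros t Ht.
    split; apply Lim_seq_correct', ex_lim_seq_cauchy_corr; intros [e He]; simpl;
      destruct (Hsmall (e / 2)) as [N HN]; try lra; exists N; intros n m Hn Hm;
      pose proof (Hunif t Ht N n Hn); pose proof (Hunif t Ht N m Hm);
      pose proof (Rabs_pos (U n t - U N t)); pose proof (Rabs_pos (V n t - V N t));
      pose proof (Rabs_pos (U m t - U N t)); pose proof (Rabs_pos (V m t - V N t)).
    - replace (U n t - U m t) with (U n t - U N t - (U m t - U N t)) by ring.
      eapply Rle_lt_trans; [apply Rabs_triang |]; rewrite Rabs_Ropp; lra.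
    - replace (V n t - V m t) with (V n t - V N t - (V m t - V N t)) by ring.
      eapply Rle_lt_trans; [apply Rabs_triang |]; rewrite Rabs_Ropp; lra. }
  assert (Hcl : forall t, Rabs (clamp (- d) d t) <= d).
  { intros t; apply Rabs_le_between, clamp_range; lra. }
  assert (Hcli : forall t, Rabs t <= d -> clamp (- d) d t = t).
  { intros t Ht; now apply clamp_id, Rabs_le_between. }
  (* clamping the time makes the limits Lipschitz on the whole line *)
  set (u := fun t => real (Lim_seq (fun n => U n (clamp (- d) d t)))).
  set (v := fun t => real (Lim_seq (fun n => V n (clamp (- d) d t)))).
  assert (Hu : forall t, is_lim_seq (fun n => U n (clamp (- d) d t)) (u t))
    by (intros t; apply Hcv, Hcl).
  assert (Hv : forall t, is_lim_seq (fun n => V n (clamp (- d) d t)) (v t))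
    by (intros t; apply Hcv, Hcl).
  assert (Hdl : - d <= d) by lra.
  assert (Hlim : forall W w, (forall n, lipschitz M (W n)) ->
      (forall t, is_lim_seq (fun n => W n (clamp (- d) d t)) (Finite (w t))) ->
      lipschitz M w).
  { intros W w HW Hw s t.
    replace (w t - w s) with (w t - w s - 0) by ring.
    apply (is_lim_seq_abs_le
             (fun n => W n (clamp (- d) d t) - W n (clamp (- d) d s))
             (w t - w s) 0 _ 0%nat).
    - now apply is_lim_seq_minus'.
    - intros n _; rewrite Rminus_0_r; eapply Rle_trans; [apply HW |].
      apply Rmult_le_compat_l; [easy |].
      pose proof (clamp_lipschitz (- d) d Hdl s t); lra. }
  assert (Hul : lipschitz M u) by (apply (Hlim U u); [apply Hlip | easy]).
  assert (Hvl : lipschitz M v) by (apply (Hlim V v); [apply Hlip | easy]).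
  assert (Hclose : forall n t, Rabs t <= d ->
      Rabs (u t - U n t) <= 2 * B * (/ 2) ^ n /\
      Rabs (v t - V n t) <= 2 * B * (/ 2) ^ n).
  { intros n t Ht; specialize (Hu t); specialize (Hv t).
    rewrite (Hcli t Ht) in Hu, Hv.
    split; [apply (is_lim_seq_abs_le _ _ _ _ n Hu) | apply (is_lim_seq_abs_le _ _ _ _ n Hv)];
      intros m Hm; pose proof (Hunif t Ht n m Hm);
      pose proof (Rabs_pos (U m t - U n t)); pose proof (Rabs_pos (V m t - V n t)); lra. }
  assert (Hfix : forall t, Rabs t <= d ->
      u t = picard_step G x u v t /\ v t = picard_step H y u v t).
  { intros t Ht.
    assert (K : forall n,
        Rabs (u t - picard_step G x u v t) <= 3 * (2 * B * (/ 2) ^ n) /\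
        Rabs (v t - picard_step H y u v t) <= 3 * (2 * B * (/ 2) ^ n)).
    { intros n; destruct (Hclose (S n) t Ht) as [C1 C2].
      assert (Hp : 0 <= B * (/ 2) ^ n) by (apply Rmult_le_pos, pow_le; lra).
      assert (He : forall s, Rabs s <= d -> Rabs (U n s - u s) + Rabs (V n s - v s)
                     <= 4 * (B * (/ 2) ^ n)).
      { intros s Hs; destruct (Hclose n s Hs).
        rewrite (Rabs_minus_sym (U n s)), (Rabs_minus_sym (V n s)); lra. }
      pose proof (picard_step_contracts G M M L x d _ (U n) (V n) u v HL HG
        (proj1 (Hlip n)) (proj2 (Hlip n)) Hul Hvl He t Ht) as P1.
      pose proof (picard_step_contracts H M M L y d _ (U n) (V n) u v HL HH
        (proj1 (Hlip n)) (proj2 (Hlip n)) Hul Hvl He t Ht) as P2.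
      rewrite <- US in P1; rewrite <- VS in P2; simpl pow in C1, C2.
      split.
      - replace (u t - picard_step G x u v t)
          with (u t - U (S n) t + (U (S n) t - picard_step G x u v t)) by ring.
        eapply Rle_trans; [apply Rabs_triang |]; nra.
      - replace (v t - picard_step H y u v t)
          with (v t - V (S n) t + (V (S n) t - picard_step H y u v t)) by ring.
        eapply Rle_trans; [apply Rabs_triang |]; nra. }
    assert (Hz : forall a b, (forall n, Rabs (a - b) <= 3 * (2 * B * (/ 2) ^ n)) -> a = b).
    { intros a b Hab; destruct (Req_dec a b) as [| Hne]; [easy | exfalso].
      assert (Hpos : 0 < Rabs (a - b)) by (apply Rabs_pos_lt; lra).
      destruct (Hsmall (Rabs (a - b) / 3)) as [n Hn]; [lra |].
      specialize (Hab n); lra. }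
    split; apply Hz; intros n; apply K. }
  assert (Hloc : forall t, Rabs t < d ->
      locally t (fun s => picard_step G x u v s = u s) /\
      locally t (fun s => picard_step H y u v s = v s)).
  { intros t Ht; assert (Hr : 0 < d - Rabs t) by lra.
    assert (Hn : forall s, Rabs (s - t) < d - Rabs t -> Rabs s <= d)
      by (intros s Hs; split_Rabs; lra).
    split; exists (mkposreal _ Hr); intros s Hs; symmetry; apply Hfix, Hn, Hs. }
  assert (H0 : Rabs 0 <= d) by (rewrite Rabs_R0; lra).
  destruct (Hfix 0 H0) as [Fu Fv].
  exists d, u, v; split; [easy |]; split; [| split; [| split; [easy | split; [easy |]]]].
  - rewrite Fu; unfold picard_step; rewrite RInt_point; unfold zero; simpl; lra.
  - rewrite Fv; unfold picard_step; rewrite RInt_point; unfold zero; simpl; lra.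
  - intros t Ht; destruct (Hloc t Ht) as [Lu Lv]; split.
    + apply (is_derive_ext_loc _ _ _ _ Lu).
      now apply picard_step_derive with M M L.
    + apply (is_derive_ext_loc _ _ _ _ Lv).
      now apply picard_step_derive with M M L.
Qed.

(** * Bounded Lipschitz fields on boxes *)

(** Closed under sums, products and quotients with denominators bounded away
    from 0, this property holds on boxes for all the rational fields at
    hand. *)
Definition tame (D : R -> R -> Prop) (F : R -> R -> R) : Prop :=
  exists M L, 0 <= M /\ 0 <= L /\ bounded_lipschitz2 D M L F.

Lemma tame_const (D : R -> R -> Prop) (c : R) : tame D (fun _ _ => c).
Proof.
  exists (Rabs c), 0; split; [apply Rabs_pos | split; [lra |]].
  intros x y _; split; [lra |]; intros x' y' _; unfold Rminus at 1.
  rewrite Rplus_opp_r, Rabs_R0; lra.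
Qed.

Lemma tame_plus (D : R -> R -> Prop) (F G : R -> R -> R) :
  tame D F -> tame D G -> tame D (fun x y => F x y + G x y).
Proof.
  intros [M [L [HM [HL HF]]]] [M' [L' [HM' [HL' HG]]]].
  exists (M + M'), (L + L'); split; [lra | split; [lra |]].
  intros x y Hxy; destruct (HF x y Hxy) as [B1 C1], (HG x y Hxy) as [B2 C2]; split.
  - eapply Rle_trans; [apply Rabs_triang | lra].
  - intros x' y' Hxy'; specialize (C1 x' y' Hxy'); specialize (C2 x' y' Hxy').
    replace (F x y + G x y - (F x' y' + G x' y'))
      with (F x y - F x' y' + (G x y - G x' y')) by ring.
    eapply Rle_trans; [apply Rabs_triang | lra].
Qed.

Lemma tame_mult (D : R -> R -> Prop) (F G : R -> R -> R) :
  tame D F -> tame D G -> tame D (fun x y => F x y * G x y).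
Proof.
  intros [M [L [HM [HL HF]]]] [M' [L' [HM' [HL' HG]]]].
  exists (M * M'), (M * L' + M' * L); split; [nra | split; [nra |]].
  intros x y Hxy; destruct (HF x y Hxy) as [B1 C1], (HG x y Hxy) as [B2 C2].
  pose proof (Rabs_pos (F x y)); pose proof (Rabs_pos (G x y)); split.
  - rewrite Rabs_mult; apply Rmult_le_compat; easy.
  - intros x' y' Hxy'; specialize (C1 x' y' Hxy'); specialize (C2 x' y' Hxy').
    destruct (HG x' y' Hxy') as [B3 _].
    replace (F x y * G x y - F x' y' * G x' y')
      with (F x y * (G x y - G x' y') + (F x y - F x' y') * G x' y') by ring.
    set (N := Rabs (x - x') + Rabs (y - y')) in *.
    pose proof (Rabs_pos (G x y - G x' y')); pose proof (Rabs_pos (F x y - F x' y')).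
    pose proof (Rabs_pos (G x' y')).
    eapply Rle_trans; [apply Rabs_triang |]; rewrite !Rabs_mult.
    assert (Rabs (F x y) * Rabs (G x y - G x' y') <= M * (L' * N))
      by (now apply Rmult_le_compat).
    assert (Rabs (F x y - F x' y') * Rabs (G x' y') <= (L * N) * M')
      by (now apply Rmult_le_compat).
    lra.
Qed.

Lemma tame_opp (D : R -> R -> Prop) (F : R -> R -> R) :
  tame D F -> tame D (fun x y => - F x y).
Proof.
  intros [M [L [HM [HL HF]]]]; exists M, L; split; [easy | split; [easy |]].
  intros x y Hxy; destruct (HF x y Hxy) as [B C]; rewrite Rabs_Ropp; split; [easy |].
  intros x' y' Hxy'; replace (- F x y - - F x' y') with (- (F x y - F x' y')) by ring.
  rewrite Rabs_Ropp; now apply C.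
Qed.

Lemma tame_minus (D : R -> R -> Prop) (F G : R -> R -> R) :
  tame D F -> tame D G -> tame D (fun x y => F x y - G x y).
Proof. intros HF HG; apply tame_plus; [easy | now apply tame_opp]. Qed.

Lemma tame_pow (D : R -> R -> Prop) (F : R -> R -> R) (n : nat) :
  tame D F -> tame D (fun x y => F x y ^ n).
Proof.
  intros HF; induction n as [| n IH]; simpl; [apply tame_const | now apply tame_mult].
Qed.

Lemma tame_inv (D : R -> R -> Prop) (F : R -> R -> R) (m : R) :
  0 < m -> (forall x y, D x y -> m <= F x y) ->
  tame D F -> tame D (fun x y => / F x y).
Proof.
  intros Hm Hlow [M [L [HM [HL HF]]]].
  assert (Hi : 0 < / m) by now apply Rinv_0_lt_compat.
  assert (Hinv : forall x y, D x y -> 0 < / F x y <= / m).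
  { intros x y Hxy; specialize (Hlow x y Hxy); split.
    - apply Rinv_0_lt_compat; lra.
    - now apply Rinv_le_contravar. }
  exists (/ m), (L * (/ m * / m)); split; [lra | split; [nra |]].
  intros x y Hxy; pose proof (Hinv x y Hxy) as I1; split; [rewrite Rabs_pos_eq; lra |].
  intros x' y' Hxy'; pose proof (Hinv x' y' Hxy') as I2.
  destruct (HF x y Hxy) as [_ C]; specialize (C x' y' Hxy').
  pose proof (Hlow x y Hxy); pose proof (Hlow x' y' Hxy').
  replace (/ F x y - / F x' y')
    with (- (F x y - F x' y') * (/ F x y * / F x' y')) by (field; lra).
  rewrite Rabs_mult, Rabs_Ropp, (Rabs_pos_eq (_ * _)) by nra.
  set (N := Rabs (x - x') + Rabs (y - y')) in *.
  replace (L * (/ m * / m) * N) with (L * N * (/ m * / m)) by ring.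
  apply Rmult_le_compat; [apply Rabs_pos | nra | easy | nra].
Qed.

Lemma tame_div (D : R -> R -> Prop) (F G : R -> R -> R) (m : R) :
  0 < m -> (forall x y, D x y -> m <= G x y) ->
  tame D F -> tame D G -> tame D (fun x y => F x y / G x y).
Proof. intros Hm Hlow HF HG; apply tame_mult; [easy | now apply tame_inv with m]. Qed.

Definition box (p1 q1 p2 q2 x y : R) : Prop := p1 <= x <= q1 /\ p2 <= y <= q2.

Lemma tame_fst (p1 q1 p2 q2 : R) : tame (box p1 q1 p2 q2) (fun x _ => x).
Proof.
  exists (Rabs p1 + Rabs q1), 1.
  pose proof (Rabs_pos p1); pose proof (Rabs_pos q1).
  split; [lra | split; [lra |]]; intros x y [Hx Hy]; split; [split_Rabs; lra |].
  intros x' y' _; pose proof (Rabs_pos (y - y')); lra.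
Qed.

Lemma tame_snd (p1 q1 p2 q2 : R) : tame (box p1 q1 p2 q2) (fun _ y => y).
Proof.
  exists (Rabs p2 + Rabs q2), 1.
  pose proof (Rabs_pos p2); pose proof (Rabs_pos q2).
  split; [lra | split; [lra |]]; intros x y [Hx Hy]; split; [split_Rabs; lra |].
  intros x' y' _; pose proof (Rabs_pos (x - x')); lra.
Qed.

Lemma bounded_lipschitz2_weaken (D : R -> R -> Prop) (M L M' L' : R) (F : R -> R -> R) :
  M <= M' -> L <= L' -> bounded_lipschitz2 D M L F -> bounded_lipschitz2 D M' L' F.
Proof.
  intros HM HL HF x y Hxy; destruct (HF x y Hxy) as [B C]; split; [lra |].
  intros x' y' Hxy'; specialize (C x' y' Hxy').
  pose proof (Rabs_pos (x - x')); pose proof (Rabs_pos (y - y')); nra.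
Qed.

(** Composing with clamping makes a field on a box global without changing it
    on the box, which is what lets [picard_lindelof] assume global bounds. *)
Lemma bounded_lipschitz2_clamp (p1 q1 p2 q2 M L : R) (F : R -> R -> R) :
  p1 <= q1 -> p2 <= q2 -> 0 <= L ->
  bounded_lipschitz2 (box p1 q1 p2 q2) M L F ->
  bounded_lipschitz2 everywhere M L (fun x y => F (clamp p1 q1 x) (clamp p2 q2 y)).
Proof.
  intros H1 H2 HL HF x y _.
  assert (HB : forall x y, box p1 q1 p2 q2 (clamp p1 q1 x) (clamp p2 q2 y))
    by (intros; split; now apply clamp_range).
  destruct (HF _ _ (HB x y)) as [B C]; split; [easy |].
  intros x' y' _; eapply Rle_trans; [apply C, HB |].
  apply Rmult_le_compat_l; [easy |].
  pose proof (clamp_lipschitz p1 q1 H1 x' x); pose proof (clamp_lipschitz p2 q2 H2 y' y).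
  lra.
Qed.

(** * Continuation of solutions past a finite endpoint *)

(** The limit is the supremum of f(t) - M (b - t): every such value lies
    below every f(s) + M (b - s), which gives the rate of convergence at the
    same time. *)
Lemma lipschitz_limit_right (f : R -> R) (a b M p q : R) :
  a < b -> 0 <= M ->
  (forall s t, a < s -> s <= t -> t < b -> Rabs (f t - f s) <= M * (t - s)) ->
  (forall t, a < t < b -> p <= f t <= q) ->
  exists l, p <= l <= q /\ forall t, a < t < b -> Rabs (f t - l) <= M * (b - t).
Proof.
  intros Hab HM Hf Hpq.
  assert (Hcross : forall s t, a < s < b -> a < t < b ->
      f t - M * (b - t) <= f s + M * (b - s)).
  { intros s t Hs Ht; destruct (Rle_dec s t).
    - assert (H : Rabs (f t - f s) <= M * (t - s)) by (apply Hf; lra).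
      apply Rabs_le_between in H; nra.
    - assert (H : Rabs (f s - f t) <= M * (s - t)) by (apply Hf; lra).
      apply Rabs_le_between in H; nra. }
  set (m := (a + b) / 2).
  destruct (completeness (fun z => exists t, a < t < b /\ z = f t - M * (b - t)))
    as [l [Hub Hlub]].
  - exists (f m + M * (b - m)); intros z [t [Ht ->]]; apply Hcross; unfold m; lra.
  - exists (f m - M * (b - m)), m; split; [unfold m; lra | easy].
  - assert (Hlt : forall t, a < t < b -> Rabs (f t - l) <= M * (b - t)).
    { intros t Ht; apply Rabs_le_between.
      assert (f t - M * (b - t) <= l) by (apply Hub; now exists t).
      assert (l <= f t + M * (b - t)).
      { apply Hlub; intros z [s [Hs ->]]; now apply Hcross. }
      lra. }
    exists l; split; [| easy].
    assert (Hnear : forall e, 0 < e -> exists t, a < t < b /\ Rabs (f t - l) <= e).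
    { intros e He.
      assert (Hq : 0 < e / (M + 1)) by (apply Rdiv_lt_0_compat; lra).
      set (h := Rmin (e / (M + 1)) ((b - a) / 2)).
      assert (Hh : 0 < h) by (apply Rmin_pos; lra).
      assert (h <= e / (M + 1)) by apply Rmin_l.
      assert (h <= (b - a) / 2) by apply Rmin_r.
      exists (b - h); split; [lra |].
      eapply Rle_trans; [apply Hlt; lra |].
      replace e with ((M + 1) * (e / (M + 1))) by (field; lra).
      replace (b - (b - h)) with h by ring; nra. }
    split; apply le_epsilon; intros e He; destruct (Hnear e He) as [t [Ht Hte]];
      specialize (Hpq t Ht); apply Rabs_le_between in Hte; lra.
Qed.

Definition paste (b : R) (u v : R -> R) : R -> R :=
  fun t => if Rlt_dec t b then u t else v t.

Lemma paste_left (b : R) (u v : R -> R) (t : R) : t < b -> paste b u v t = u t.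
Proof. intros H; unfold paste; now destruct (Rlt_dec t b). Qed.

Lemma paste_right (b : R) (u v : R -> R) (t : R) : b <= t -> paste b u v t = v t.
Proof. intros H; unfold paste; destruct (Rlt_dec t b); [lra | easy]. Qed.

Lemma paste_derive_left (b : R) (u v : R -> R) (t d : R) :
  t < b -> is_derive u t d -> is_derive (paste b u v) t d.
Proof.
  intros Ht; apply is_derive_ext_loc.
  apply (filter_imp (fun s => s < b)); [| now apply open_lt].
  intros s Hs; symmetry; now apply paste_left.
Qed.

Lemma paste_derive_right (b : R) (u v : R -> R) (t d : R) :
  b < t -> is_derive v t d -> is_derive (paste b u v) t d.
Proof.
  intros Ht; apply is_derive_ext_loc.
  apply (filter_imp (fun s => b < s)); [| now apply open_gt].
  intros s Hs; symmetry; apply paste_right; now left.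
Qed.

Lemma is_derive_continuous (f : R -> R) (x d : R) : is_derive f x d -> continuous f x.
Proof. intros H; apply (ex_derive_continuous f); now exists d. Qed.

Lemma lipschitz_at_continuous (f : R -> R) (x r K : R) :
  0 < r -> 0 <= K ->
  (forall y, Rabs (y - x) < r -> Rabs (f y - f x) <= K * Rabs (y - x)) ->
  continuous f x.
Proof.
  intros Hr HK Hf; apply continuity_pt_filterlim; intros e He.
  assert (Hq : 0 < e / (K + 1)) by (apply Rdiv_lt_0_compat; lra).
  exists (Rmin r (e / (K + 1))); split; [now apply Rmin_pos |].
  intros y [_ Hy]; simpl in Hy |- *; unfold R_dist in *.
  pose proof (Rmin_l r (e / (K + 1))); pose proof (Rmin_r r (e / (K + 1))).
  eapply Rle_lt_trans; [apply Hf; lra |].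
  replace e with ((K + 1) * (e / (K + 1))) by (field; lra).
  pose proof (Rabs_pos (y - x)); nra.
Qed.

(** Both pieces approach the junction value at a linear rate, so the pasted
    function is continuous there; its derivative [phi] is continuous at the
    junction too, and [is_derive_removable] applies. *)
Lemma paste_derive (b r K : R) (u v phi : R -> R) :
  0 < r -> 0 <= K ->
  (forall t, b - r < t < b -> is_derive u t (phi t) /\ Rabs (u t - v b) <= K * (b - t)) ->
  (forall t, b < t < b + r -> is_derive v t (phi t) /\ Rabs (v t - v b) <= K * (t - b)) ->
  (forall t, b - r < t < b + r -> Rabs (phi t - phi b) <= K * Rabs (t - b)) ->
  forall t, b - r < t < b + r -> is_derive (paste b u v) t (phi t).
Proof.
  intros Hr HK Hu Hv Hphi.
  assert (Hoff : forall t, t <> b -> b - r < t < b + r ->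
      is_derive (paste b u v) t (phi t)).
  { intros t Hne Ht; destruct (Rlt_dec t b).
    - apply paste_derive_left; [easy | apply Hu; lra].
    - apply paste_derive_right; [lra | apply Hv; lra]. }
  intros t Ht; destruct (Req_dec t b) as [-> | Hne]; [| now apply Hoff].
  apply is_derive_removable with r; [easy | |].
  - intros y Hy; apply Rabs_lt_between in Hy.
    destruct (Req_dec y b) as [-> | Hne];
      [| apply is_derive_continuous with (phi y), Hoff; [easy | lra]].
    apply lipschitz_at_continuous with r K; [easy | easy |].
    intros y Hyb; apply Rabs_lt_between in Hyb.
    rewrite (paste_right b u v b) by lra.
    destruct (Rlt_dec y b).
    + rewrite paste_left, (Rabs_left (y - b)) by lra.
      replace (- (y - b)) with (b - y) by ring; apply Hu; lra.
    + rewrite paste_right, (Rabs_pos_eq (y - b)) by lra.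
      destruct (Req_dec y b) as [-> |]; [| apply Hv; lra].
      rewrite !Rminus_eq_0, Rabs_R0; lra.
  - intros e He.
    assert (Hq : 0 < e / (K + 1)) by (apply Rdiv_lt_0_compat; lra).
    exists (Rmin r (e / (K + 1))); split; [now apply Rmin_pos |].
    intros y Hne Hy.
    pose proof (Rmin_l r (e / (K + 1))); pose proof (Rmin_r r (e / (K + 1))).
    assert (Hyr : b - r < y < b + r) by (split_Rabs; lra).
    exists (phi y); split; [now apply Hoff |].
    eapply Rle_trans; [now apply Hphi |].
    replace e with ((K + 1) * (e / (K + 1))) by (field; lra).
    pose proof (Rabs_pos (y - b)); nra.
Qed.

Lemma derivative_bound_lipschitz (f : R -> R) (a b M : R) :
  (forall t, a < t < b -> exists d, is_derive f t d /\ Rabs d <= M) ->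
  forall s t, a < s -> s <= t -> t < b -> Rabs (f t - f s) <= M * (t - s).
Proof.
  intros Hf s t Hs Hst Ht.
  assert (Hc : forall x, s <= x <= t -> continuous f x).
  { intros x Hx; destruct (Hf x) as [d [Hd _]]; [lra |].
    now apply is_derive_continuous with d. }
  assert (U : f t - f s <= M * (t - s)).
  { apply mean_value_upper; [easy | easy |]; intros x Hx.
    destruct (Hf x) as [d [Hd Hb]]; [lra |]; exists d; split; [easy |].
    apply Rabs_le_between in Hb; lra. }
  assert (L : - M * (t - s) <= f t - f s).
  { apply mean_value_lower; [easy | easy |]; intros x Hx.
    destruct (Hf x) as [d [Hd Hb]]; [lra |]; exists d; split; [easy |].
    apply Rabs_le_between in Hb; lra. }
  apply Rabs_le_between; lra.
Qed.

Lemma is_derive_shift (f : R -> R) (b t l : R) :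
  is_derive f (t - b) l -> is_derive (fun s => f (s - b)) t l.
Proof.
  intros Hf; replace l with (1 * l) by ring.
  apply (is_derive_comp f (fun s => s - b)); [easy |].
  auto_derive; [easy | ring].
Qed.

(** A solution confined to a box near [b] has a limit at [b], since its speed
    is bounded; the local solution started at that limit continues it.  The
    larger box leaves room for the continuation, which must stay in the domain
    where the field is tame. *)
Lemma ode_extension (F G : R -> R -> R) (u v : R -> R)
    (a t0 b p1 q1 p2 q2 P1 Q1 P2 Q2 : R) :
  a <= t0 < b -> P1 < p1 -> q1 < Q1 -> P2 < p2 -> q2 < Q2 ->
  tame (box P1 Q1 P2 Q2) F -> tame (box P1 Q1 P2 Q2) G ->
  (forall t, a < t < b ->
     is_derive u t (F (u t) (v t)) /\ is_derive v t (G (u t) (v t))) ->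
  (forall t, t0 < t < b -> box p1 q1 p2 q2 (u t) (v t)) ->
  exists d w z, 0 < d /\ (forall t, t < b -> w t = u t /\ z t = v t) /\
    (forall t, b <= t < b + d -> box P1 Q1 P2 Q2 (w t) (z t)) /\
    forall t, a < t < b + d ->
      is_derive w t (F (w t) (z t)) /\ is_derive z t (G (w t) (z t)).
Proof.
  intros Hab HP1 HQ1 HP2 HQ2 [M1 [L1 [HM1 [HL1 HF]]]] [M2 [L2 [HM2 [HL2 HG]]]] Hd Hbox.
  assert (Hbig : forall t, t0 < t < b -> box P1 Q1 P2 Q2 (u t) (v t)).
  { intros t Ht; destruct (Hbox t Ht); split; lra. }
  set (M := M1 + M2); set (L := L1 + L2).
  assert (HM : 0 <= M) by (unfold M; lra).
  assert (HL : 0 <= L) by (unfold L; lra).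
  apply (bounded_lipschitz2_weaken _ _ _ M L) in HF; [| unfold M; lra | unfold L; lra].
  apply (bounded_lipschitz2_weaken _ _ _ M L) in HG; [| unfold M; lra | unfold L; lra].
  destruct (lipschitz_limit_right u t0 b M p1 q1) as [x [Hx Hux]]; [lra | easy | | |].
  { apply derivative_bound_lipschitz; intros t Ht; destruct (Hd t) as [Du _]; [lra |].
    eexists; split; [exact Du | now apply HF, Hbig]. }
  { intros t Ht; now apply Hbox. }
  destruct (lipschitz_limit_right v t0 b M p2 q2) as [y [Hy Hvy]]; [lra | easy | | |].
  { apply derivative_bound_lipschitz; intros t Ht; destruct (Hd t) as [_ Dv]; [lra |].
    eexists; split; [exact Dv | now apply HG, Hbig]. }
  { intros t Ht; now apply Hbox. }
  set (cF := fun s t => F (clamp P1 Q1 s) (clamp P2 Q2 t)).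
  set (cG := fun s t => G (clamp P1 Q1 s) (clamp P2 Q2 t)).
  destruct (picard_lindelof cF cG M L x y) as [d0 [u1 [v1 [Hd0 [Iu [Iv [Lu [Lv Hode]]]]]]]];
    [easy | easy | | |].
  { apply bounded_lipschitz2_clamp; [lra | lra | easy | exact HF]. }
  { apply bounded_lipschitz2_clamp; [lra | lra | easy | exact HG]. }
  set (r := Rmin (Rmin (x - P1) (Q1 - x)) (Rmin (y - P2) (Q2 - y))).
  assert (Hr : 0 < r /\ P1 <= x - r /\ x + r <= Q1 /\ P2 <= y - r /\ y + r <= Q2).
  { split; [repeat apply Rmin_pos; lra |]; unfold r.
    pose proof (Rmin_l (Rmin (x - P1) (Q1 - x)) (Rmin (y - P2) (Q2 - y))).
    pose proof (Rmin_r (Rmin (x - P1) (Q1 - x)) (Rmin (y - P2) (Q2 - y))).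
    pose proof (Rmin_l (x - P1) (Q1 - x)); pose proof (Rmin_r (x - P1) (Q1 - x)).
    pose proof (Rmin_l (y - P2) (Q2 - y)); pose proof (Rmin_r (y - P2) (Q2 - y)); lra. }
  assert (Hrq : 0 < r / (M + 1)) by (apply Rdiv_lt_0_compat; lra).
  set (d := Rmin (Rmin d0 (r / (M + 1))) (b - t0)).
  assert (Hdd : 0 < d /\ d <= d0 /\ d <= r / (M + 1) /\ d <= b - t0).
  { split; [repeat apply Rmin_pos; lra |]; unfold d.
    pose proof (Rmin_l (Rmin d0 (r / (M + 1))) (b - t0)).
    pose proof (Rmin_r (Rmin d0 (r / (M + 1))) (b - t0)).
    pose proof (Rmin_l d0 (r / (M + 1))); pose proof (Rmin_r d0 (r / (M + 1))); lra. }
  assert (HMd : M * d <= r).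
  { replace r with ((M + 1) * (r / (M + 1))) by (field; lra); nra. }
  set (w := paste b u (fun t => u1 (t - b))); set (z := paste b v (fun t => v1 (t - b))).
  assert (Hnear : forall t, b - d < t < b + d ->
      Rabs (w t - x) <= M * Rabs (t - b) /\ Rabs (z t - y) <= M * Rabs (t - b)).
  { intros t Ht; unfold w, z; destruct (Rlt_dec t b).
    - rewrite !paste_left, (Rabs_left (t - b)) by lra.
      replace (- (t - b)) with (b - t) by ring; split; [apply Hux | apply Hvy]; lra.
    - rewrite !paste_right by lra; rewrite <- Iu, <- Iv.
      replace (t - b) with (t - b - 0) at 2 4 by ring; split; [apply Lu | apply Lv]. }
  assert (Hwz : forall t, b - d < t < b + d -> box P1 Q1 P2 Q2 (w t) (z t)).
  { intros t Ht; destruct (Hnear t Ht) as [N1 N2].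
    assert (M * Rabs (t - b) <= M * d)
      by (apply Rmult_le_compat_l; [easy | split_Rabs; lra]).
    apply Rabs_le_between in N1, N2; split; lra. }
  assert (Hcl : forall H t, b - d < t < b + d ->
      H (clamp P1 Q1 (w t)) (clamp P2 Q2 (z t)) = H (w t) (z t) :> R).
  { intros H t Ht; destruct (Hwz t Ht); now rewrite !clamp_id. }
  assert (Hwb : w b = x /\ z b = y).
  { unfold w, z; rewrite !paste_right, Rminus_eq_0 by lra; easy. }
  assert (Hb : b - d < b < b + d) by lra.
  assert (HML : M <= M + L * (2 * M)) by nra.
  assert (Hphi : forall H, bounded_lipschitz2 (box P1 Q1 P2 Q2) M L H ->
      forall t, b - d < t < b + d ->
      Rabs (H (w t) (z t) - H (w b) (z b)) <= (M + L * (2 * M)) * Rabs (t - b)).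
  { intros H HH t Ht; destruct (HH _ _ (Hwz t Ht)) as [_ C].
    eapply Rle_trans; [apply C, Hwz, Hb |]; destruct (Hnear t Ht).
    rewrite (proj1 Hwb), (proj2 Hwb); pose proof (Rabs_pos (t - b)); nra. }
  exists d, w, z; split; [easy |]; split; [| split].
  - intros t Ht; split; now apply paste_left.
  - intros t Ht; apply Hwz; lra.
  - assert (Hin : forall t, b - d < t < b + d ->
        is_derive w t (F (w t) (z t)) /\ is_derive z t (G (w t) (z t))).
    { intros t Ht; split.
      - apply (paste_derive b d (M + L * (2 * M)) u (fun t => u1 (t - b))
                 (fun t => F (w t) (z t))); [easy | lra | | | | easy].
        + intros s Hs; split.
          * unfold w, z; rewrite !paste_left by lra; apply Hd; lra.
          * rewrite Rminus_eq_0, Iu; eapply Rle_trans; [apply Hux; lra |].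
            apply Rmult_le_compat_r; lra.
        + intros s Hs; split.
          * apply is_derive_shift; rewrite <- (Hcl F s) by lra.
            unfold w, z; rewrite !paste_right by lra; apply Hode; split_Rabs; lra.
          * rewrite Rminus_eq_0; eapply Rle_trans; [apply Lu |].
            rewrite Rminus_0_r, Rabs_pos_eq by lra; apply Rmult_le_compat_r; lra.
        + now apply Hphi.
      - apply (paste_derive b d (M + L * (2 * M)) v (fun t => v1 (t - b))
                 (fun t => G (w t) (z t))); [easy | lra | | | | easy].
        + intros s Hs; split.
          * unfold w, z; rewrite !paste_left by lra; apply Hd; lra.
          * rewrite Rminus_eq_0, Iv; eapply Rle_trans; [apply Hvy; lra |].
            apply Rmult_le_compat_r; lra.
        + intros s Hs; split.
          * apply is_derive_shift; rewrite <- (Hcl G s) by lra.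
            unfold w, z; rewrite !paste_right by lra; apply Hode; split_Rabs; lra.
          * rewrite Rminus_eq_0; eapply Rle_trans; [apply Lv |].
            rewrite Rminus_0_r, Rabs_pos_eq by lra; apply Rmult_le_compat_r; lra.
        + now apply Hphi. }
    intros t Ht; destruct (Rlt_dec t b); [| apply Hin; lra].
    destruct (Hd t) as [Du Dv]; [lra |].
    unfold w, z; rewrite !(paste_left b _ _ t) by easy.
    split; now apply paste_derive_left.
Qed.

(** * The cubic of the nullcline *)
Definition cubic (alpha A C : R) : R :=
  4 * A ^ 3 + 2 * A ^ 2 * C - 8 * alpha * A ^ 2 - 12 * alpha * A * C - 5 * alpha * C ^ 2.

Lemma rg2_dA_cubic (alpha A C : R) :
  0 < A -> rg2_dA alpha A C = 2 * cubic alpha A C / A ^ 3.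
Proof. intros HA; unfold rg2_dA, cubic; field; lra. Qed.

(** Orbits of the system are trajectories: dA/dt = (dA/dC) (dC/dt). *)
Lemma rg2_dA_chain (alpha A C : R) :
  0 < alpha -> 0 < A -> 0 < C ->
  rg2_dA alpha A C = trajectory_rhs alpha A C * rg2_dC alpha A C.
Proof.
  intros Ha HA HC; rewrite rg2_dA_cubic by easy.
  unfold trajectory_rhs, rg2_dC; fold (cubic alpha A C).
  assert (0 < 2 * A ^ 2 + alpha * C).
  { pose proof (pow_lt A 2 HA); nra. }
  field; split; [lra | split; lra].
Qed.

Lemma rg2_dC_negative (alpha A C : R) :
  0 < alpha -> 0 < A -> 0 < C -> rg2_dC alpha A C < 0.
Proof.
  intros Ha HA HC; unfold rg2_dC.
  assert (0 < 4 * C ^ 2 / A ^ 2).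
  { apply Rdiv_lt_0_compat; [| now apply pow_lt].
    pose proof (pow_lt C 2 HC); lra. }
  assert (0 < 2 * alpha * (C ^ 3 / A ^ 4)).
  { apply Rmult_lt_0_compat; [lra |].
    apply Rdiv_lt_0_compat; now apply pow_lt. }
  lra.
Qed.

Lemma cubic_factored (alpha A C : R) :
  0 < A ->
  cubic alpha A C =
  A ^ 2 * (A * (4 + 2 * (C / A)) - alpha * (8 + 12 * (C / A) + 5 * (C / A) ^ 2)).
Proof. intros HA; unfold cubic; field; lra. Qed.

(** With s = C/A, the cubic is A^2 W(s) (A - alpha Q(s)), where
    W(s) = 4 + 2s and Q(s) = (8 + 12s + 5s^2) / W(s) is increasing; the ratio
    s drops when A grows and C drops.  The statement is the monotonicity of Q
    with denominators cleared. *)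
Lemma cubic_ratio_le (alpha A C A' C' : R) :
  0 < alpha -> 0 < A -> A <= A' -> 0 < C' -> C' <= C ->
  let s := C / A in let s' := C' / A' in
  0 < s' /\
  (4 + 2 * s') * (A * (4 + 2 * s) - alpha * (8 + 12 * s + 5 * s ^ 2))
  <= (4 + 2 * s) * (A * (4 + 2 * s') - alpha * (8 + 12 * s' + 5 * s' ^ 2)).
Proof.
  intros Ha HA HAA HC HCC s s'.
  assert (Hs' : 0 < s') by (apply Rdiv_lt_0_compat; lra).
  assert (Hss : s' <= s).
  { unfold s, s', Rdiv; apply Rmult_le_compat; try lra.
    - left; apply Rinv_0_lt_compat; lra.
    - now apply Rinv_le_contravar. }
  split; [easy |].
  assert (E : 0 <= (s - s') * (32 + 20 * (s + s') + 10 * (s * s'))).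
  { apply Rmult_le_pos; [lra | nra]. }
  assert (0 <= alpha * ((s - s') * (32 + 20 * (s + s') + 10 * (s * s'))))
    by (apply Rmult_le_pos; lra).
  lra.
Qed.

Lemma cubic_positive_mono (alpha A C A' C' : R) :
  0 < alpha -> 0 < A -> A <= A' -> 0 < C' -> C' <= C ->
  0 < cubic alpha A C -> 0 < cubic alpha A' C'.
Proof.
  intros Ha HA HAA HC HCC; rewrite !cubic_factored by lra.
  destruct (cubic_ratio_le alpha A C A' C') as [Hs' Hr]; try easy.
  assert (Hs : 0 < C / A) by (apply Rdiv_lt_0_compat; lra).
  set (s := C / A) in *; set (s' := C' / A') in *.
  pose proof (pow_lt A 2 HA); assert (0 < A' ^ 2) by (apply pow_lt; lra).
  intros H1; apply Rmult_lt_0_compat; [easy |].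
  assert (H2 : 0 < A * (4 + 2 * s) - alpha * (8 + 12 * s + 5 * s ^ 2)) by nra.
  assert (H3 : 0 < A * (4 + 2 * s') - alpha * (8 + 12 * s' + 5 * s' ^ 2)).
  { apply Rmult_lt_reg_l with (4 + 2 * s); [lra |].
    rewrite Rmult_0_r; eapply Rlt_le_trans; [| exact Hr].
    apply Rmult_lt_0_compat; lra. }
  nra.
Qed.

Lemma cubic_positive_above_root (alpha A C A' C' : R) :
  0 < alpha -> 0 < A -> A < A' -> 0 < C' -> C' <= C ->
  cubic alpha A C = 0 -> 0 < cubic alpha A' C'.
Proof.
  intros Ha HA HAA HC HCC; rewrite !cubic_factored by lra.
  destruct (cubic_ratio_le alpha A C A' C') as [Hs' Hr]; try lra.
  assert (Hs : 0 < C / A) by (apply Rdiv_lt_0_compat; lra).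
  set (s := C / A) in *; set (s' := C' / A') in *.
  pose proof (pow_lt A 2 HA); assert (0 < A' ^ 2) by (apply pow_lt; lra).
  intros H1; apply Rmult_lt_0_compat; [easy |].
  assert (H2 : A * (4 + 2 * s) - alpha * (8 + 12 * s + 5 * s ^ 2) = 0) by nra.
  rewrite H2, Rmult_0_r in Hr.
  assert (H3 : 0 <= A * (4 + 2 * s') - alpha * (8 + 12 * s' + 5 * s' ^ 2)) by nra.
  nra.
Qed.

(** For A <= 2 alpha every group of terms of the cubic is nonpositive, and
    the term in C^2 is negative. *)
Lemma cubic_root_gt (alpha A C : R) :
  0 < alpha -> 0 < A -> 0 < C -> cubic alpha A C = 0 -> 2 * alpha < A.
Proof.
  intros Ha HA HC E; destruct (Rlt_dec (2 * alpha) A) as [| Hn]; [easy | exfalso].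
  unfold cubic in E.
  assert (0 <= A ^ 2 * (2 * alpha - A)) by (apply Rmult_le_pos; [apply pow2_ge_0 | lra]).
  assert (0 < A * C) by nra.
  assert (0 <= A * C * (6 * alpha - A)) by (apply Rmult_le_pos; lra).
  assert (0 < alpha * C ^ 2) by (apply Rmult_lt_0_compat; [lra | now apply pow_lt]).
  nra.
Qed.

Lemma nullcline_root (alpha : R) (g : R -> R) (C : R) :
  0 < alpha -> trajectory_nullcline alpha g -> 0 < C ->
  0 < g C /\ cubic alpha (g C) C = 0.
Proof.
  intros Ha Hg HC; destruct (Hg C HC) as [Hp Hz]; split; [easy |].
  destruct (Hz (g C) Hp) as [_ E]; specialize (E eq_refl).
  unfold trajectory_rhs in E; fold (cubic alpha (g C) C) in E.
  assert (0 < C ^ 2 * (2 * g C ^ 2 + alpha * C)).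
  { apply Rmult_lt_0_compat; [now apply pow_lt |].
    pose proof (pow_lt (g C) 2 Hp); nra. }
  set (k := C ^ 2 * (2 * g C ^ 2 + alpha * C)) in *.
  assert (E' : g C * cubic alpha (g C) C = 0).
  { replace (g C * cubic alpha (g C) C)
      with (- (- (g C * cubic alpha (g C) C / k)) * k) by (field; lra).
    rewrite E; ring. }
  nra.
Qed.

Lemma below_nullcline (alpha : R) (g : R -> R) (A C b : R) :
  0 < alpha -> trajectory_nullcline alpha g -> 0 < A -> 0 < C -> C <= b ->
  cubic alpha A C <= 0 -> A <= g b.
Proof.
  intros Ha Hg HA HC Hb Hq.
  destruct (nullcline_root alpha g b Ha Hg) as [Hp E]; [lra |].
  destruct (Rle_dec A (g b)) as [| Hn]; [easy | exfalso].
  assert (0 < cubic alpha A C) by (apply (cubic_positive_above_root _ (g b) b); lra).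
  lra.
Qed.

Ltac tame_tac :=
  repeat first
    [ apply tame_const | apply tame_fst | apply tame_snd
    | apply tame_minus | apply tame_plus | apply tame_opp
    | apply tame_pow | apply tame_mult ].

(** * Invariance and comparison *)
Lemma trajectory_rhs_tame (alpha p1 q1 p2 q2 : R) :
  0 < alpha -> 0 < p1 -> 0 < p2 ->
  tame (box p1 q1 p2 q2) (trajectory_rhs alpha).
Proof.
  intros Ha H1 H2.
  apply (tame_opp _ (fun A C => A * (4 * A ^ 3 + 2 * A ^ 2 * C - 8 * alpha * A ^ 2
          - 12 * alpha * A * C - 5 * alpha * C ^ 2)
     / (C ^ 2 * (2 * A ^ 2 + alpha * C)))).
  apply tame_div with (p2 ^ 2 * (alpha * p2)); [| | tame_tac | tame_tac].
  - apply Rmult_lt_0_compat; [now apply pow_lt | nra].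
  - intros A C [HA HC]; apply Rmult_le_compat; [apply pow2_ge_0 | nra | |].
    + apply pow_incr; lra.
    + pose proof (pow2_ge_0 A); nra.
Qed.

Lemma rg2_dA_tame (alpha p1 q1 p2 q2 : R) :
  0 < p1 -> tame (box p1 q1 p2 q2) (rg2_dA alpha).
Proof.
  intros H1; unfold rg2_dA.
  assert (Hpow : forall n A C, box p1 q1 p2 q2 A C -> p1 ^ n <= A ^ n).
  { intros n A C [HA _]; apply pow_incr; lra. }
  apply tame_minus; [apply tame_plus; [tame_tac | apply tame_mult; [tame_tac |]] |
                     apply tame_mult; [tame_tac |]].
  - apply (tame_div _ _ _ p1); [easy | intros A C [HA _]; lra | tame_tac | tame_tac].
  - apply (tame_div _ _ _ (p1 ^ 3)); [now apply pow_lt | apply Hpow | tame_tac | tame_tac].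
Qed.

Lemma rg2_dC_tame (alpha p1 q1 p2 q2 : R) :
  0 < p1 -> tame (box p1 q1 p2 q2) (rg2_dC alpha).
Proof.
  intros H1; unfold rg2_dC.
  assert (Hpow : forall n A C, box p1 q1 p2 q2 A C -> p1 ^ n <= A ^ n).
  { intros n A C [HA _]; apply pow_incr; lra. }
  apply tame_minus; [apply tame_opp | apply tame_mult; [tame_tac |]].
  - apply (tame_div _ _ _ (p1 ^ 2)); [now apply pow_lt | apply Hpow | tame_tac | tame_tac].
  - apply (tame_div _ _ _ (p1 ^ 4)); [now apply pow_lt | apply Hpow | tame_tac | tame_tac].
Qed.

Lemma cubic_continuous (alpha : R) (A C : R -> R) (t : R) :
  continuous A t -> continuous C t -> continuous (fun t => cubic alpha (A t) (C t)) t.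
Proof.
  intros HA HC; apply continuity_pt_filterlim.
  apply continuity_pt_filterlim in HA, HC.
  unfold cubic; reg.
Qed.

(** As long as the cubic is positive, A does not decrease, while C never
    increases; both changes only move the point deeper into the region of
    positivity, so the boundary is not reached. *)
Lemma positive_cubic_persists (alpha : R) (A C : R -> R) (a b : R) :
  0 < alpha -> a <= b ->
  (forall t, a <= t <= b -> 0 < A t /\ 0 < C t /\ continuous A t /\ continuous C t) ->
  (forall s t, a <= s -> s <= t -> t <= b -> C t <= C s) ->
  (forall t, a < t < b -> 0 < cubic alpha (A t) (C t) ->
     exists d, is_derive A t d /\ 0 <= d) ->
  0 < cubic alpha (A a) (C a) ->
  0 < cubic alpha (A b) (C b) /\ A a <= A b.
Proof.
  intros Ha Hab Hreg HC Hd H0.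
  assert (Hmono : forall s, a <= s <= b ->
      (forall r, a <= r < s -> 0 < cubic alpha (A r) (C r)) -> A a <= A s).
  { intros s Hs Hr; enough (0 * (s - a) <= A s - A a) by lra.
    apply mean_value_lower; [lra | |].
    - intros x Hx; apply Hreg; lra.
    - intros x Hx; apply Hd; [lra | apply Hr; lra]. }
  assert (Hpos : forall t, a <= t <= b -> 0 < cubic alpha (A t) (C t)).
  { apply (positive_propagates (fun t => cubic alpha (A t) (C t)));
      [easy | | easy |].
    - intros x Hx; apply cubic_continuous; now apply Hreg.
    - intros s Hs Hr.
      apply (cubic_positive_mono alpha (A a) (C a)); try easy.
      + apply Hreg; lra.
      + apply Hmono; [lra | easy].
      + apply Hreg; lra.
      + apply HC; lra. }
  split; [apply Hpos; lra |].
  apply Hmono; [lra |]; intros r Hr; apply Hpos; lra.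
Qed.

(** The difference D = A - y(C) satisfies
    D' = (f(A,C) - f(y(C),C)) C', which is at most a constant times |D|,
    because f is Lipschitz on a box containing both curves.  The curve (A,C)
    may be an orbit of the system, or a second trajectory with C(t) = t. *)
Lemma trajectory_noncrossing (alpha K : R) (A C y : R -> R) (a b : R) :
  0 < alpha -> a <= b ->
  (forall t, a <= t <= b -> 0 < A t /\ 0 < C t /\ continuous A t /\ continuous C t) ->
  (forall t, a <= t <= b -> 0 < y (C t) /\
     is_derive y (C t) (trajectory_rhs alpha (y (C t)) (C t))) ->
  (forall t, a < t < b -> exists c, is_derive C t c /\ Rabs c <= K /\
     is_derive A t (trajectory_rhs alpha (A t) (C t) * c)) ->
  (y (C a) < A a <-> y (C b) < A b).
Proof.
  intros Ha Hab Hreg Hy Hd.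
  assert (Hyc : forall t, a <= t <= b -> continuous (fun t => y (C t)) t).
  { intros t Ht; apply (continuous_comp C y); [now apply Hreg |].
    eapply is_derive_continuous; now apply Hy. }
  destruct (continuous_positive_bounds A a b) as [m1 [M1 [Hm1 HA]]]; try easy;
    try (intros t Ht; now apply Hreg).
  destruct (continuous_positive_bounds C a b) as [m2 [M2 [Hm2 HC]]]; try easy;
    try (intros t Ht; now apply Hreg).
  destruct (continuous_positive_bounds (fun t => y (C t)) a b) as [m3 [M3 [Hm3 HyC]]];
    try easy; try (intros t Ht; now apply Hy).
  destruct (trajectory_rhs_tame alpha (Rmin m1 m3) (Rmax M1 M3) m2 M2)
    as [M [L [_ [HL Hf]]]]; [easy | now apply Rmin_pos | easy |].
  pose proof (Rmin_l m1 m3); pose proof (Rmin_r m1 m3).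
  pose proof (Rmax_l M1 M3); pose proof (Rmax_r M1 M3).
  assert (Hs : 0 < A a - y (C a) <-> 0 < A b - y (C b)).
  { apply (gronwall_sign (fun t => A t - y (C t)) a b (L * K)); [easy | |].
    - intros t Ht; apply (continuous_minus A (fun t => y (C t))); [| now apply Hyc].
      now apply Hreg.
    - intros t Ht; destruct (Hd t Ht) as [c [HdC [Hc HdA]]].
      assert (Ht' : a <= t <= b) by lra.
      specialize (HA t Ht'); specialize (HC t Ht'); specialize (HyC t Ht').
      exists (trajectory_rhs alpha (A t) (C t) * c
              - c * trajectory_rhs alpha (y (C t)) (C t)); split.
      + apply (is_derive_minus A (fun t => y (C t))); [easy |].
        apply (is_derive_comp y C); [now apply Hy | easy].
      + replace (trajectory_rhs alpha (A t) (C t) * c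
              - c * trajectory_rhs alpha (y (C t)) (C t))
          with ((trajectory_rhs alpha (A t) (C t)
                 - trajectory_rhs alpha (y (C t)) (C t)) * c) by ring.
        destruct (Hf (A t) (C t)) as [_ Hl]; [split; lra |].
        specialize (Hl (y (C t)) (C t)).
        rewrite Rminus_eq_0, Rabs_R0, Rplus_0_r in Hl.
        rewrite Rabs_mult.
        replace (L * K * Rabs (A t - y (C t))) with (L * Rabs (A t - y (C t)) * K) by ring.
        apply Rmult_le_compat; try apply Rabs_pos; [| easy].
        apply Hl; split; lra. }
  lra.
Qed.

(** * The trajectories issued from the nullcline *)
Lemma trajectory_rhs_sign (alpha A C : R) :
  0 < alpha -> 0 < A -> 0 < C ->
  (cubic alpha A C <= 0 -> 0 <= trajectory_rhs alpha A C) /\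
  (0 < cubic alpha A C -> trajectory_rhs alpha A C <= 0).
Proof.
  intros Ha HA HC; unfold trajectory_rhs; fold (cubic alpha A C).
  assert (Hk : 0 < C ^ 2 * (2 * A ^ 2 + alpha * C)).
  { apply Rmult_lt_0_compat; [now apply pow_lt |].
    pose proof (pow_lt A 2 HA); nra. }
  apply Rinv_0_lt_compat in Hk.
  set (k := / (C ^ 2 * (2 * A ^ 2 + alpha * C))) in *.
  unfold Rdiv; fold k; split; intros H.
  - assert (0 <= A * - cubic alpha A C * k) by (repeat apply Rmult_le_pos; lra).
    lra.
  - assert (0 <= A * cubic alpha A C * k) by (repeat apply Rmult_le_pos; lra).
    lra.
Qed.

(** When C is reversed, positivity of the cubic would propagate from [d] down
    to [c], where the cubic vanishes. *)
Lemma trajectory_stays_below_nullcline (alpha c d : R) (y : R -> R) :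
  0 < alpha -> 0 < c -> c <= d ->
  (forall x, c <= x <= d ->
     0 < y x /\ is_derive y x (trajectory_rhs alpha (y x) x)) ->
  cubic alpha (y c) c = 0 ->
  cubic alpha (y d) d <= 0.
Proof.
  intros Ha Hc Hcd Hy E.
  destruct (Rle_dec (cubic alpha (y d) d) 0) as [| Hn]; [easy | exfalso].
  (* run the trajectory with time s = - x *)
  assert (H : 0 < cubic alpha (y (- - c)) (- - c) /\ y (- - d) <= y (- - c)).
  { apply (positive_cubic_persists alpha (fun s => y (- s)) (fun s => - s) (- d) (- c));
      [easy | lra | | | |].
    - intros t Ht.
      assert (Hop : continuous (fun s : R => - s) t).
      { apply (ex_derive_continuous (fun s : R => - s)); auto_derive; easy. }
      split; [apply Hy; lra | split; [lra | split; [| easy]]].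
      apply (continuous_comp (fun s : R => - s) y); [easy |].
      eapply is_derive_continuous; apply Hy; lra.
    - intros s t Hs Hst Ht; lra.
    - intros t Ht Hp; destruct (Hy (- t)) as [Hpos Hder]; [lra |].
      exists (-1 * trajectory_rhs alpha (y (- t)) (- t)); split.
      + apply (is_derive_comp y (fun s : R => - s)); [easy |].
        auto_derive; [easy | ring].
      + apply trajectory_rhs_sign in Hp; lra.
    - rewrite Ropp_involutive; lra. }
  rewrite Ropp_involutive, E in H; lra.
Qed.

(** Below the nullcline [y] is nondecreasing in C, so on a bounded interval
    [1/n, b) it stays between g(1/n) and g(b); it can then be continued past
    [b], against maximality.  Hence the domain reaches infinity. *)
Lemma nullcline_trajectory_global (alpha : R) (g : R -> R) (n : nat) (y : R -> R) :
  0 < alpha -> trajectory_nullcline alpha g -> (1 <= n)%nat ->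
  nullcline_trajectory alpha g n y ->
  (forall x, / INR n <= x ->
     0 < y x /\ is_derive y x (trajectory_rhs alpha (y x) x)) /\
  y (/ INR n) = g (/ INR n) /\
  (forall x, / INR n <= x -> cubic alpha (y x) x <= 0 /\ g (/ INR n) <= y x).
Proof.
  intros Ha Hg Hn [a [b [Hac [Hcb [[[Ha0 Hsol] Hmax] Hini]]]]].
  assert (Hc : 0 < / INR n) by (apply Rinv_0_lt_compat, lt_0_INR; lia).
  set (c := / INR n) in *.
  assert (Hbelow : forall x, c <= x -> Rbar_lt x b -> cubic alpha (y x) x <= 0).
  { intros x Hx Hxb; apply trajectory_stays_below_nullcline with c; try easy.
    - intros z Hz; apply Hsol; [lra |].
      now apply Rbar_le_lt_trans with x.
    - rewrite Hini; now apply nullcline_root. }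
  assert (Hmono : forall x, c <= x -> Rbar_lt x b -> g c <= y x).
  { intros x Hx Hxb; rewrite <- Hini; enough (0 * (x - c) <= y x - y c) by lra.
    assert (Hin : forall z, c <= z <= x -> Rbar_lt z b)
      by (intros z Hz; now apply Rbar_le_lt_trans with x).
    apply mean_value_lower; [easy | |]; intros z Hz.
    - eapply is_derive_continuous; apply Hsol; [lra | now apply Hin].
    - eexists; split; [apply Hsol; [lra | apply Hin; lra] |].
      apply trajectory_rhs_sign; try lra.
      + apply Hsol; [lra | apply Hin; lra].
      + apply Hbelow; [lra | apply Hin; lra]. }
  assert (Hb : b = p_infty).
  { destruct b as [b | |]; [exfalso | easy | easy].
    simpl in Hcb.
    destruct (nullcline_root alpha g c Ha Hg Hc) as [Hgc _].
    destruct (ode_extension (trajectory_rhs alpha) (fun _ _ => 1) y (fun x => x)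
                a c b (g c) (g b) c b (g c / 2) (g b + 1) (c / 2) (b + 1))
      as [d [w [z [Hd [Hag [Hbx Hwz]]]]]]; try lra.
    - apply trajectory_rhs_tame; lra.
    - apply tame_const.
    - intros t Ht; split; [apply Hsol; [lra | simpl; lra] |].
      apply (is_derive_id t).
    - intros t Ht; assert (Htb : Rbar_lt t b) by (simpl; lra).
      split; [split |]; [apply Hmono; [lra | easy] | | lra].
      apply (below_nullcline alpha g (y t) t b); try lra; try easy.
      + apply Hsol; [lra | easy].
      + apply Hbelow; [lra | easy].
    - assert (Ez : forall t, a < t < b + d -> z t = t).
      { intros t Ht; destruct (Rlt_dec t b) as [| Htb]; [now apply Hag |].
        assert (Ec : z c = c) by now apply Hag.
        assert (Hzd : forall s, c <= s <= t -> is_derive z s 1)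
          by (intros s Hs; apply Hwz; lra).
        assert (1 * (t - c) <= z t - z c /\ z t - z c <= 1 * (t - c)).
        { split; [apply mean_value_lower | apply mean_value_upper]; try lra;
            intros s Hs;
            try (apply is_derive_continuous with 1, Hzd; lra);
            exists 1; split; try lra; apply Hzd; lra. }
        lra. }
      enough (E : a = a /\ Finite (b + d) = Finite b).
      { destruct E as [_ E]; injection E; lra. }
      apply (Hmax a (Finite (b + d)) w); [lra | simpl; lra | |].
      + split; [easy |]; intros x Hx Hxb; simpl in Hxb.
        assert (Hxd : a < x < b + d) by lra.
        destruct (Hwz x Hxd) as [Hder _]; rewrite (Ez x Hxd) in Hder.
        split; [| easy].
        destruct (Rlt_dec x b) as [Hlt | Hge].
        * rewrite (proj1 (Hag x Hlt)); now apply Hsol.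
        * destruct (Hbx x) as [? _]; lra.
      + intros x Hx Hxb; now apply Hag. }
  subst b; split; [| split; [easy |]].
  - intros x Hx; apply Hsol; [lra | easy].
  - intros x Hx; split; [now apply Hbelow | now apply Hmono].
Qed.

Lemma inv_INR_eventually (C : R) :
  0 < C -> exists N : nat, (1 <= N)%nat /\ forall n, (N <= n)%nat -> / INR n < C.
Proof.
  intros HC; destruct (archimed_cor1 C HC) as [N [HN HN0]].
  exists N; split; [lia |]; intros n Hn.
  eapply Rle_lt_trans; [| exact HN].
  apply Rinv_le_contravar; [apply lt_0_INR; lia | now apply le_INR].
Qed.

(** At C = 1/n the later trajectory is below the nullcline, hence below
    g(1/n), which is where the earlier one starts; they do not cross
    afterwards. *)
Lemma nullcline_trajectories_decrease (alpha : R) (g : R -> R) (m n : nat)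
    (y z : R -> R) (C : R) :
  0 < alpha -> trajectory_nullcline alpha g -> (1 <= n)%nat -> (n <= m)%nat ->
  nullcline_trajectory alpha g n y -> nullcline_trajectory alpha g m z ->
  / INR n <= C -> z C <= y C.
Proof.
  intros Ha Hg Hn Hnm Hy Hz HC.
  assert (Hc : 0 < / INR n) by (apply Rinv_0_lt_compat, lt_0_INR; lia).
  assert (Hmn : / INR m <= / INR n)
    by (apply Rinv_le_contravar; [apply lt_0_INR; lia | now apply le_INR]).
  destruct (nullcline_trajectory_global alpha g n y Ha Hg Hn Hy) as [Sy [Iy _]].
  destruct (nullcline_trajectory_global alpha g m z) as [Sz [_ Bz]]; try easy; [lia |].
  assert (H0 : z (/ INR n) <= y (/ INR n)).
  { rewrite Iy; apply (below_nullcline alpha g _ (/ INR n)); try easy; try lra.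
    - now apply Sz.
    - now apply Bz. }
  destruct (Rle_dec (z C) (y C)) as [| Hlt]; [easy | exfalso].
  enough (y (/ INR n) < z (/ INR n)) by lra.
  apply (trajectory_noncrossing alpha 1 z (fun t => t) y (/ INR n) C); try easy.
  - intros t Ht; repeat split; [apply Sz; lra | lra | | apply continuous_id].
    eapply is_derive_continuous; apply Sz; lra.
  - intros t Ht; apply Sy; lra.
  - intros t Ht; exists 1; split; [apply (is_derive_id t) | split].
    + rewrite Rabs_R1; lra.
    + rewrite Rmult_1_r; apply Sz; lra.
  - lra.
Qed.

Lemma separating_solution_below (alpha : R) (g phi : R -> R) (phin : nat -> R -> R)
    (n : nat) (C : R) :
  0 < alpha -> trajectory_nullcline alpha g ->
  (forall n : nat, (1 <= n)%nat -> nullcline_trajectory alpha g n (phin n)) ->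
  is_lim_seq (fun n => phin n C) (phi C) ->
  (1 <= n)%nat -> / INR n <= C -> phi C <= phin n C.
Proof.
  intros Ha Hg Hphin Hlim Hn HC.
  apply (is_lim_seq_le_loc (fun m => phin m C) (fun _ => phin n C) (phi C) (phin n C));
    [| easy | apply is_lim_seq_const].
  exists n; intros m Hm.
  apply (nullcline_trajectories_decrease alpha g m n); try easy.
  - now apply Hphin.
  - apply Hphin; lia.
Qed.

(** * Regularized form of the flow *)

(** A solution on [0, T) extended to negative times by its initial value is
    continuous everywhere before [T], so that the mean value lemmas apply on
    intervals [0, t] without one-sided notions. *)
Definition interior_solution (alpha : R) (T : Rbar) (A C : R -> R) : Prop :=
  forall t : R, Rbar_lt t T ->
    0 < A t /\ 0 < C t /\ continuous A t /\ continuous C t /\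
    (0 < t -> is_derive A t (rg2_dA alpha (A t) (C t)) /\
              is_derive C t (rg2_dC alpha (A t) (C t))).

Lemma forward_interval_local (T : Rbar) (t : R) :
  Rbar_lt t T -> exists r, 0 < r /\ forall s, s < t + r -> Rbar_lt s T.
Proof.
  intros Ht; destruct T as [T | |]; simpl in *; [| | easy].
  - exists (T - t); split; [lra | intros; lra].
  - exists 1; split; [lra | easy].
Qed.

Lemma D_in_is_derive (f : R -> R) (df : R -> R) (T : Rbar) (t : R) :
  0 < t -> Rbar_lt t T -> D_in f df (forward_interval T) t -> is_derive f t (df t).
Proof.
  intros Ht HtT HD; apply is_derive_Reals; intros e He.
  destruct (HD e He) as [d [Hd Hlim]].
  destruct (forward_interval_local T t HtT) as [r [Hr Hloc]].
  assert (Hm : 0 < Rmin d (Rmin r t)) by (repeat apply Rmin_pos; lra).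
  exists (mkposreal _ Hm); simpl; intros h Hh Hhm.
  pose proof (Rmin_l d (Rmin r t)); pose proof (Rmin_r d (Rmin r t)).
  pose proof (Rmin_l r t); pose proof (Rmin_r r t).
  assert (Hb : - Rmin d (Rmin r t) < h < Rmin d (Rmin r t))
    by now apply Rabs_lt_between.
  specialize (Hlim (t + h)); simpl in Hlim; unfold R_dist in Hlim.
  replace (t + h - t) with h in Hlim by ring; apply Hlim.
  split; [split; [split; [lra | apply Hloc; lra] | lra] | lra].
Qed.

Lemma D_in_right_continuous (f : R -> R) (df : R -> R) (T : Rbar) :
  Rbar_lt 0 T -> D_in f df (forward_interval T) 0 ->
  continuous (fun t => f (Rmax 0 t)) 0.
Proof.
  intros HT HD; apply continuity_pt_filterlim; intros e He.
  destruct (cont_deriv _ _ _ _ HD e He) as [d [Hd Hlim]].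
  destruct (forward_interval_local T 0 HT) as [r [Hr Hloc]].
  exists (Rmin d r); split; [now apply Rmin_pos |].
  intros s [_ Hs]; simpl in Hs |- *; unfold R_dist in *.
  pose proof (Rmin_l d r); pose proof (Rmin_r d r).
  rewrite (Rmax_left 0 0) by lra.
  destruct (Rle_dec s 0) as [Hs0 | Hs0].
  - rewrite Rmax_left by easy; rewrite Rminus_eq_0, Rabs_R0; lra.
  - rewrite Rmax_right by lra.
    apply (Hlim s); simpl; unfold R_dist; split; [split; [| lra] | lra].
    split; [lra | apply Hloc; split_Rabs; lra].
Qed.

Lemma interior_solution_clamped (alpha : R) (T : Rbar) (A C : R -> R) :
  Rbar_lt 0 T -> rg2_solution alpha T A C ->
  interior_solution alpha T (fun t => A (Rmax 0 t)) (fun t => C (Rmax 0 t)).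
Proof.
  intros HT Hsol t Ht.
  assert (Hm : Rbar_lt (Rmax 0 t) T) by (unfold Rmax; destruct (Rle_dec 0 t); easy).
  destruct (Hsol (Rmax 0 t)) as [HA [HC _]]; [split; [apply Rmax_l | easy] |].
  assert (Hder : 0 < t ->
    is_derive (fun t => A (Rmax 0 t)) t (rg2_dA alpha (A (Rmax 0 t)) (C (Rmax 0 t))) /\
    is_derive (fun t => C (Rmax 0 t)) t (rg2_dC alpha (A (Rmax 0 t)) (C (Rmax 0 t)))).
  { intros Hp; rewrite Rmax_right by lra.
    destruct (Hsol t) as [_ [_ [DC DA]]]; [split; [lra | easy] |].
    assert (Hloc : forall f : R -> R, locally t (fun s => f s = f (Rmax 0 s))).
    { intros f; apply (filter_imp (fun s => 0 < s)); [| now apply open_gt].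
      intros s Hs; rewrite Rmax_right; [easy | now left]. }
    split; (eapply is_derive_ext_loc; [apply Hloc |]).
    - now apply (D_in_is_derive A (fun s => rg2_dA alpha (A s) (C s)) T).
    - now apply (D_in_is_derive C (fun s => rg2_dC alpha (A s) (C s)) T). }
  assert (Hcont : continuous (fun t => A (Rmax 0 t)) t /\
                  continuous (fun t => C (Rmax 0 t)) t).
  { destruct (total_order_T t 0) as [[Hneg | ->] | Hpos].
    - assert (Hloc : forall f : R -> R, locally t (fun s => f (Rmax 0 s) = f (Rmax 0 t))).
      { intros f; apply (filter_imp (fun s => s < 0)); [| now apply open_lt].
        intros s Hs; rewrite !Rmax_left; [easy | lra | now left]. }
      split; (eapply continuous_ext_loc;
        [eapply filter_imp; [| apply Hloc]; intros s Hs; symmetry; exact Hs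
        | apply continuous_const]).
    - destruct (Hsol 0) as [_ [_ [DC DA]]]; [split; [lra | easy] |].
      split; eapply D_in_right_continuous; eassumption.
    - destruct (Hder Hpos); split; eapply is_derive_continuous; eassumption. }
  split; [easy | split; [easy | split; [apply Hcont | split; [apply Hcont | easy]]]].
Qed.

Lemma D_in_of_is_derive (f : R -> R) (df : R -> R) (D : R -> Prop) (t : R) :
  is_derive f t (df t) -> D_in f df D t.
Proof.
  intros Hf e He; apply is_derive_Reals in Hf.
  destruct (Hf e He) as [[d Hd] Hlim]; simpl in Hlim.
  assert (Hquot : forall s, t <> s -> Rabs (s - t) < d ->
      Rabs ((f s - f t) / (s - t) - df t) < e).
  { intros s Hne Hs; specialize (Hlim (s - t)).
    replace (t + (s - t)) with s in Hlim by ring; apply Hlim; [lra | easy]. }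
  exists d; split; [easy |].
  intros s [[_ Hne] Hs]; now apply Hquot.
Qed.

Lemma D_in_local (f f' df df' : R -> R) (D D' : R -> Prop) (t r : R) :
  0 < r ->
  (forall s, Rabs (s - t) < r -> D' s -> D s /\ f' s = f s) ->
  f' t = f t -> df' t = df t -> D_in f df D t -> D_in f' df' D' t.
Proof.
  intros Hr Hloc Ef Ed HD e He; destruct (HD e He) as [d [Hd Hlim]].
  exists (Rmin d r); split; [now apply Rmin_pos |].
  pose proof (Rmin_l d r); pose proof (Rmin_r d r).
  intros s [[Hs Hne] Hdist]; simpl in Hdist |- *; unfold R_dist in *.
  destruct (Hloc s) as [HDs Efs]; [lra | easy |].
  rewrite Efs, Ef, Ed; apply (Hlim s); simpl; unfold R_dist.
  split; [split; [easy | easy] | lra].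
Qed.

(** The continuation given by [ode_extension] is a solution on a longer
    interval; its derivatives relative to the domain agree with the old ones
    before [T], and are ordinary derivatives from [T] on. *)
Lemma maximal_solution_leaves_boxes (alpha T : R) (A C : R -> R) (p1 q1 p2 q2 : R) :
  0 < p1 -> 0 < p2 ->
  rg2_maximal_solution alpha T A C ->
  (forall t, 0 < t < T -> box p1 q1 p2 q2 (A t) (C t)) -> False.
Proof.
  intros Hp1 Hp2 [HT [Hsol Hmax]] Hbox; simpl in HT.
  assert (Hder : forall t, 0 < t < T ->
      is_derive A t (rg2_dA alpha (A t) (C t)) /\
      is_derive C t (rg2_dC alpha (A t) (C t))).
  { intros t Ht; destruct (Hsol t) as [_ [_ [DC DA]]]; [split; simpl; lra |].
    split.
    - apply (D_in_is_derive A (fun s => rg2_dA alpha (A s) (C s)) T); simpl; easy.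
    - apply (D_in_is_derive C (fun s => rg2_dC alpha (A s) (C s)) T); simpl; easy. }
  destruct (ode_extension (rg2_dA alpha) (rg2_dC alpha) A C 0 0 T p1 q1 p2 q2
              (p1 / 2) (q1 + 1) (p2 / 2) (q2 + 1))
    as [d [w [z [Hd [Hag [Hbx Hwz]]]]]]; try lra; try easy.
  - apply rg2_dA_tame; lra.
  - apply rg2_dC_tame; lra.
  - enough (E : Finite (T + d) = Finite T) by (injection E; lra).
    apply (Hmax (T + d) w z); [simpl; lra | |].
    + intros t [Ht0 HtT]; simpl in HtT.
      destruct (Rlt_dec t T) as [Hlt | Hge].
      * destruct (Hag t Hlt) as [Ew Ez].
        destruct (Hsol t) as [HA [HC [DC DA]]]; [split; simpl; easy |].
        rewrite Ew, Ez; split; [easy |]; split; [easy |].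
        assert (Hloc : forall f f' : R -> R, (forall s, s < T -> f' s = f s) ->
          forall s, Rabs (s - t) < T - t -> forward_interval (T + d) s ->
            forward_interval T s /\ f' s = f s).
        { intros f f' Hff s Hs [Hs0 _].
          assert (s < T) by (split_Rabs; lra).
          split; [split; simpl; easy | now apply Hff]. }
        assert (HtT' : 0 < T - t) by lra.
        split; (eapply D_in_local;
          [exact HtT' | apply Hloc; intros s Hs; now apply Hag | easy | | eassumption]);
          simpl; now rewrite Ew, Ez.
      * destruct (Hbx t) as [Bw Bz]; [lra |].
        destruct (Hwz t) as [Dw Dz]; [lra |].
        split; [lra | split; [lra |]]; split; now apply D_in_of_is_derive.
    + intros t [_ Ht]; simpl in Ht; now apply Hag.
Qed.

(** * Elementary estimates along the flow *)
Lemma Rbar_lt_below (T : Rbar) (s t : R) : s <= t -> Rbar_lt t T -> Rbar_lt s T.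
Proof. intros Hst Ht; now apply Rbar_le_lt_trans with t. Qed.

Lemma flow_C_antitone (alpha : R) (T : Rbar) (A C : R -> R) (s t : R) :
  0 < alpha -> interior_solution alpha T A C ->
  0 <= s -> s <= t -> Rbar_lt t T -> C t <= C s.
Proof.
  intros Ha Hsol Hs Hst Ht; enough (C t - C s <= 0 * (t - s)) by lra.
  apply mean_value_upper; [easy | |]; intros x Hx;
    destruct (Hsol x) as [HA [HC [_ [HcC Hd]]]];
    try (apply (Rbar_lt_below T x t); [lra | easy]); [easy |].
  exists (rg2_dC alpha (A x) (C x)); split; [apply Hd; lra |].
  left; now apply rg2_dC_negative.
Qed.

Lemma rg2_dA_sign (alpha A C : R) :
  0 < A ->
  (cubic alpha A C <= 0 -> rg2_dA alpha A C <= 0) /\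
  (0 < cubic alpha A C -> 0 <= rg2_dA alpha A C).
Proof.
  intros HA; rewrite rg2_dA_cubic by easy.
  pose proof (Rinv_0_lt_compat _ (pow_lt A 3 HA)) as Hi; unfold Rdiv; split; nra.
Qed.

Lemma flow_A_antitone (alpha : R) (T : Rbar) (A C : R -> R) (s t : R) :
  interior_solution alpha T A C ->
  0 <= s -> s <= t -> Rbar_lt t T ->
  (forall r, s <= r <= t -> cubic alpha (A r) (C r) <= 0) -> A t <= A s.
Proof.
  intros Hsol Hs Hst Ht Hq; enough (A t - A s <= 0 * (t - s)) by lra.
  apply mean_value_upper; [easy | |]; intros x Hx;
    destruct (Hsol x) as [HA [HC [HcA [_ Hd]]]];
    try (apply (Rbar_lt_below T x t); [lra | easy]); [easy |].
  exists (rg2_dA alpha (A x) (C x)); split; [apply Hd; lra |].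
  apply rg2_dA_sign; [easy | apply Hq; lra].
Qed.

Lemma flow_positive_cubic_persists (alpha : R) (T : Rbar) (A C : R -> R) (s t : R) :
  0 < alpha -> interior_solution alpha T A C ->
  0 <= s -> s <= t -> Rbar_lt t T -> 0 < cubic alpha (A s) (C s) ->
  0 < cubic alpha (A t) (C t) /\ A s <= A t.
Proof.
  intros Ha Hsol Hs Hst Ht Hq.
  apply positive_cubic_persists; try easy.
  - intros x Hx; destruct (Hsol x) as [HA [HC [HcA [HcC _]]]]; [| easy].
    apply (Rbar_lt_below T x t); [lra | easy].
  - intros x y Hx Hxy Hy; apply (flow_C_antitone alpha T A C); try easy; [lra |].
    now apply (Rbar_lt_below T y t).
  - intros x Hx Hp; destruct (Hsol x) as [HA [_ [_ [_ Hd]]]];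
      [apply (Rbar_lt_below T x t); [lra | easy] |].
    exists (rg2_dA alpha (A x) (C x)); split; [apply Hd; lra |].
    now apply rg2_dA_sign.
Qed.

(** The function 1/C is the convenient clock: its growth depends only on A,
    up to a term linear in C. *)
Lemma flow_inverse_C (alpha : R) (T : Rbar) (A C : R -> R) (t : R) :
  interior_solution alpha T A C -> Rbar_lt t T ->
  continuous (fun t => / C t) t /\
  (0 < t -> is_derive (fun t => / C t) t
              (4 * (/ A t) ^ 2 + 2 * alpha * C t * (/ A t) ^ 4)).
Proof.
  intros Hsol Ht; destruct (Hsol t Ht) as [HA [HC [_ [HcC Hd]]]]; split.
  - apply (continuous_comp C Rinv); [easy |].
    apply (ex_derive_continuous Rinv); auto_derive; lra.
  - intros Hp; destruct (Hd Hp) as [_ DC].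
    replace (4 * (/ A t) ^ 2 + 2 * alpha * C t * (/ A t) ^ 4)
      with (- rg2_dC alpha (A t) (C t) / C t ^ 2)
      by (unfold rg2_dC; field; lra).
    apply is_derive_inv; [easy | lra].
Qed.

Lemma flow_inverse_C_ge (alpha : R) (T : Rbar) (A C : R -> R) (s t M : R) :
  0 < alpha -> interior_solution alpha T A C ->
  0 <= s -> s <= t -> Rbar_lt t T ->
  (forall r, s <= r <= t -> A r <= M) ->
  4 * (/ M) ^ 2 * (t - s) <= / C t - / C s.
Proof.
  intros Ha Hsol Hs Hst Ht HM.
  assert (Hin : forall x, s <= x <= t -> Rbar_lt x T)
    by (intros x Hx; apply (Rbar_lt_below T x t); [lra | easy]).
  apply (mean_value_lower (fun t => / C t)); [easy | |]; intros x Hx.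
  - apply (flow_inverse_C alpha T A); [easy | now apply Hin].
  - destruct (flow_inverse_C alpha T A C x Hsol) as [_ Hd]; [apply Hin; lra |].
    eexists; split; [apply Hd; lra |].
    destruct (Hsol x) as [HA [HC _]]; [apply Hin; lra |].
    assert (0 < / A x) by now apply Rinv_0_lt_compat.
    assert (/ M <= / A x) by (apply Rinv_le_contravar; [easy | apply HM; lra]).
    assert (0 < / M) by (apply Rinv_0_lt_compat, Rlt_le_trans with (A x);
      [easy | apply HM; lra]).
    assert ((/ M) ^ 2 <= (/ A x) ^ 2) by (apply pow_incr; lra).
    assert (0 <= 2 * alpha * C x * (/ A x) ^ 4)
      by (repeat apply Rmult_le_pos; try lra; apply pow_le; lra).
    lra.
Qed.

Lemma flow_inverse_C_le (alpha : R) (T : Rbar) (A C : R -> R) (s t m : R) :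
  0 < alpha -> interior_solution alpha T A C ->
  0 <= s -> s <= t -> Rbar_lt t T -> 0 < m ->
  (forall r, s <= r <= t -> m <= A r) ->
  / C t - / C s <= (4 * (/ m) ^ 2 + 2 * alpha * C s * (/ m) ^ 4) * (t - s).
Proof.
  intros Ha Hsol Hs Hst Ht Hm0 Hm.
  assert (Hin : forall x, s <= x <= t -> Rbar_lt x T)
    by (intros x Hx; apply (Rbar_lt_below T x t); [lra | easy]).
  apply (mean_value_upper (fun t => / C t)); [easy | |]; intros x Hx.
  - apply (flow_inverse_C alpha T A); [easy | now apply Hin].
  - destruct (flow_inverse_C alpha T A C x Hsol) as [_ Hd]; [apply Hin; lra |].
    eexists; split; [apply Hd; lra |].
    destruct (Hsol x) as [HA [HC _]]; [apply Hin; lra |].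
    assert (C x <= C s)
      by (apply (flow_C_antitone alpha T A C); try easy; try lra; apply Hin; lra).
    assert (0 < / A x) by now apply Rinv_0_lt_compat.
    assert (/ A x <= / m) by (apply Rinv_le_contravar; [easy | apply Hm; lra]).
    assert ((/ A x) ^ 2 <= (/ m) ^ 2) by (apply pow_incr; lra).
    assert (2 * alpha * C x * (/ A x) ^ 4 <= 2 * alpha * C s * (/ m) ^ 4).
    { apply Rmult_le_compat; [nra | apply pow_le; lra | nra | apply pow_incr; lra]. }
    lra.
Qed.

Lemma flow_trajectory_noncrossing (alpha : R) (T : Rbar) (A C y : R -> R) (c t : R) :
  0 < alpha -> interior_solution alpha T A C -> 0 <= t -> Rbar_lt t T ->
  (forall x, c <= x -> 0 < y x /\ is_derive y x (trajectory_rhs alpha (y x) x)) ->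
  c <= C t -> (y (C 0) < A 0 <-> y (C t) < A t).
Proof.
  intros Ha Hsol Ht0 Ht Hy Hc.
  assert (Hin : forall x, 0 <= x <= t -> Rbar_lt x T)
    by (intros x Hx; apply (Rbar_lt_below T x t); [lra | easy]).
  destruct (continuous_positive_bounds A 0 t) as [m1 [M1 [Hm1 HA]]]; try easy;
    try (intros x Hx; now apply Hsol, Hin).
  destruct (continuous_positive_bounds C 0 t) as [m2 [M2 [Hm2 HC]]]; try easy;
    try (intros x Hx; now apply Hsol, Hin).
  destruct (rg2_dC_tame alpha m1 M1 m2 M2 Hm1) as [K [L [_ [_ HK]]]].
  apply (trajectory_noncrossing alpha K); try easy.
  - intros x Hx; destruct (Hsol x (Hin x Hx)) as [H1 [H2 [H3 [H4 _]]]]; easy.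
  - intros x Hx; apply Hy.
    enough (C t <= C x) by lra.
    apply (flow_C_antitone alpha T A C); try easy; lra.
  - intros x Hx; assert (Hx' : 0 <= x <= t) by lra.
    destruct (Hsol x (Hin x Hx')) as [HAx [HCx [_ [_ Hd]]]].
    exists (rg2_dC alpha (A x) (C x)); split; [apply Hd; lra |]; split.
    + apply HK; split; [now apply HA | now apply HC].
    + rewrite <- rg2_dA_chain by easy; apply Hd; lra.
Qed.

Lemma rg2_dA_upper (alpha A C m N : R) :
  0 < alpha -> 0 < m -> m <= A -> 0 < C -> C <= N ->
  rg2_dA alpha A C <= 8 + 4 * (N / m).
Proof.
  intros Ha Hm HA HC HN; unfold rg2_dA.
  assert (C / A <= N / m).
  { apply Rmult_le_compat; [lra | left; apply Rinv_0_lt_compat; lra | easy |].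
    now apply Rinv_le_contravar. }
  assert (0 <= alpha * ((16 * A ^ 2 + 24 * A * C + 10 * C ^ 2) / A ^ 3)).
  { apply Rmult_le_pos; [lra |]; apply Rmult_le_pos.
    - pose proof (pow2_ge_0 A); pose proof (pow2_ge_0 C); nra.
    - left; apply Rinv_0_lt_compat, pow_lt; lra. }
  lra.
Qed.

(** The constant term of this bound is positive exactly when m > 2 alpha, and
    the rest vanishes with C. *)
Lemma rg2_dA_lower (alpha A C m N : R) :
  0 < alpha -> 0 < m -> m <= A -> 0 < C -> C <= N ->
  8 - 16 * alpha * / m - alpha * (24 * (/ m) ^ 2 + 10 * N * (/ m) ^ 3) * C
  <= rg2_dA alpha A C.
Proof.
  intros Ha Hm HA HC HN.
  assert (E : rg2_dA alpha A C = 8 + 4 * (C * / A)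
     - alpha * (16 * / A + (24 * (/ A) ^ 2 + 10 * C * (/ A) ^ 3) * C))
    by (unfold rg2_dA; field; lra).
  rewrite E; clear E.
  assert (Hi : 0 < / A) by (apply Rinv_0_lt_compat; lra).
  assert (Him : / A <= / m) by now apply Rinv_le_contravar.
  assert (H2 : (/ A) ^ 2 <= (/ m) ^ 2) by (apply pow_incr; lra).
  assert (H3 : (/ A) ^ 3 <= (/ m) ^ 3) by (apply pow_incr; lra).
  assert (H4 : C * (/ A) ^ 3 <= N * (/ m) ^ 3).
  { apply Rmult_le_compat; [lra | apply pow_le; lra | easy | easy]. }
  assert (H5 : 0 <= C * / A) by (apply Rmult_le_pos; lra).
  assert (H6 : (24 * (/ A) ^ 2 + 10 * C * (/ A) ^ 3) * C
               <= (24 * (/ m) ^ 2 + 10 * N * (/ m) ^ 3) * C)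
    by (apply Rmult_le_compat_r; lra).
  assert (H7 : alpha * (16 * / A + (24 * (/ A) ^ 2 + 10 * C * (/ A) ^ 3) * C)
     <= alpha * (16 * / m + (24 * (/ m) ^ 2 + 10 * N * (/ m) ^ 3) * C))
    by (apply Rmult_le_compat_l; lra).
  lra.
Qed.

(** * Orbits above the separating solution *)

(** Since A <= M, the function 1/C grows at least linearly, so C -> 0; then
    [rg2_dA_lower] bounds dA/dt from below by a positive constant, and A
    exceeds [M]. *)
Lemma no_bounded_immortal_flow (alpha m M t1 : R) (A C : R -> R) :
  0 < alpha -> 2 * alpha < m -> 0 <= t1 ->
  interior_solution alpha p_infty A C ->
  (forall t, t1 <= t -> m <= A t <= M) -> False.
Proof.
  intros Ha Hm Ht1 Hsol HA.
  assert (HmM : m <= M) by (specialize (HA t1); lra).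
  assert (HC0 : 0 < C t1) by now apply (Hsol t1).
  set (N := C t1) in *.
  set (k := 8 - 16 * alpha * / m).
  assert (Hk : 0 < k).
  { assert (alpha * / m < / 2).
    { apply Rmult_lt_reg_r with m; [lra |]; rewrite Rmult_assoc, Rinv_l by lra; lra. }
    unfold k; lra. }
  set (S := alpha * (24 * (/ m) ^ 2 + 10 * N * (/ m) ^ 3)).
  assert (Him : 0 < / m) by (apply Rinv_0_lt_compat; lra).
  assert (HS : 0 < S).
  { unfold S; apply Rmult_lt_0_compat; [easy |].
    pose proof (pow_lt _ 2 Him); pose proof (pow_lt _ 3 Him); nra. }
  (* the time after which the C-terms of A' have size at most k / 2 *)
  set (e := k / (2 * S)).
  assert (He : 0 < e) by (apply Rdiv_lt_0_compat; lra).
  set (t2 := t1 + M ^ 2 / (4 * e)).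
  assert (HM2 : 0 < M ^ 2) by (apply pow_lt; lra).
  assert (Ht2 : t1 < t2).
  { unfold t2; enough (0 < M ^ 2 / (4 * e)) by lra.
    apply Rdiv_lt_0_compat; lra. }
  assert (HCe : forall t, t2 <= t -> C t <= e).
  { intros t Ht.
    pose proof (flow_inverse_C_ge alpha p_infty A C t1 t M Ha Hsol Ht1) as HI.
    assert (HI' : 4 * (/ M) ^ 2 * (t - t1) <= / C t - / C t1).
    { apply HI; [lra | easy |]; intros r Hr; apply HA; lra. }
    assert (HCt : 0 < C t) by now apply (Hsol t).
    assert (0 < / C t1) by now apply Rinv_0_lt_compat.
    assert (HiM : 0 < / M) by (apply Rinv_0_lt_compat; lra).
    assert (/ e <= 4 * (/ M) ^ 2 * (t - t1)).
    { apply Rle_trans with (4 * (/ M) ^ 2 * (t2 - t1)).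
      - unfold t2; right; field; lra.
      - apply Rmult_le_compat_l; [| lra].
        pose proof (pow_lt _ 2 HiM); lra. }
    rewrite <- (Rinv_inv (C t)), <- (Rinv_inv e).
    apply Rinv_le_contravar; [now apply Rinv_0_lt_compat | lra]. }
  set (t3 := t2 + 2 * (M + 1) / k).
  assert (Ht3 : t2 <= t3).
  { unfold t3; enough (0 < 2 * (M + 1) / k) by lra; apply Rdiv_lt_0_compat; lra. }
  assert (HG : k / 2 * (t3 - t2) <= A t3 - A t2).
  { apply mean_value_lower; [easy | |]; intros x Hx;
      destruct (Hsol x I) as [HAx [HCx [HcA [_ Hd]]]]; [easy |].
    exists (rg2_dA alpha (A x) (C x)); split; [apply Hd; lra |].
    assert (C x <= N)
      by (apply (flow_C_antitone alpha p_infty A C); try easy; lra).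
    eapply Rle_trans; [| apply (rg2_dA_lower alpha (A x) (C x) m N)]; try lra.
    - fold k S.
      assert (S * C x <= S * e) by (apply Rmult_le_compat_l; [lra | apply HCe; lra]).
      replace (S * e) with (k / 2) in H0 by (unfold e; field; lra); lra.
    - apply HA; lra. }
  replace (k / 2 * (t3 - t2)) with (M + 1) in HG by (unfold t3; field; lra).
  pose proof (HA t3); pose proof (HA t2); lra.
Qed.

(** What maximality gives for the regularized flow: an orbit that stays in a
    compact subset of the open quarter plane is immortal. *)
Definition leaves_boxes (T : Rbar) (A C : R -> R) : Prop :=
  forall p1 q1 p2 q2, 0 < p1 -> 0 < p2 ->
    (forall t, 0 < t -> Rbar_lt t T -> box p1 q1 p2 q2 (A t) (C t)) -> T = p_infty.

(** The lower bound A >= g(1/n) > 2 alpha is established first.  Since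
    bounded immortal orbits are excluded, the cubic must become positive at
    some time, and from then on A increases without bound. *)
Lemma flow_above_separatrix (alpha : R) (T : Rbar) (A C g y : R -> R) (n : nat) :
  0 < alpha -> Rbar_lt 0 T -> interior_solution alpha T A C -> leaves_boxes T A C ->
  trajectory_nullcline alpha g -> (1 <= n)%nat -> nullcline_trajectory alpha g n y ->
  / INR n <= C 0 -> y (C 0) < A 0 ->
  T = p_infty /\ forall M, exists t1, 0 <= t1 /\ forall t, t1 <= t -> M < A t.
Proof.
  intros Ha HT Hsol Hleave Hg Hn Hy HnC HyA.
  assert (Hc : 0 < / INR n) by (apply Rinv_0_lt_compat, lt_0_INR; lia).
  destruct (nullcline_trajectory_global alpha g n y Ha Hg Hn Hy) as [Sy [Iy By]].
  set (c := / INR n) in *.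
  destruct (nullcline_root alpha g c Ha Hg Hc) as [Hgc Egc].
  assert (Hgc2 : 2 * alpha < g c) by now apply (cubic_root_gt alpha (g c) c).
  set (m := g c) in *.
  assert (HmA : forall t, 0 <= t -> Rbar_lt t T -> m <= A t).
  { intros t Ht HtT.
    destruct (Rle_dec c (C t)) as [HcC | HcC].
    - destruct (flow_trajectory_noncrossing alpha T A C y c t) as [Hcr _]; try easy.
      specialize (Hcr HyA); destruct (By (C t) HcC); lra.
    - destruct (intermediate_zero (fun t => C t - c) 0 t) as [r [Hr Er]]; [easy | | nra |].
      { intros x Hx; apply (continuous_minus C (fun _ => c)); [| apply continuous_const].
        apply Hsol, (Rbar_lt_below T x t); [lra | easy]. }
      assert (HrT : Rbar_lt r T) by (apply (Rbar_lt_below T r t); [lra | easy]).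
      assert (ECr : C r = c) by lra.
      destruct (flow_trajectory_noncrossing alpha T A C y c r) as [Hcr _]; try easy; try lra.
      specialize (Hcr HyA); rewrite ECr, Iy in Hcr.
      destruct (flow_positive_cubic_persists alpha T A C r t) as [_ Hmon]; try easy; try lra.
      apply (cubic_positive_above_root alpha m c); try lra. }
  assert (HCN : forall t, 0 <= t -> Rbar_lt t T -> C t <= C 0)
    by (intros t Ht HtT; apply (flow_C_antitone alpha T A C); try easy; lra).
  assert (HC0 : 0 < C 0) by now apply (Hsol 0).
  assert (HTinf : T = p_infty).
  { destruct T as [T | |]; [| easy | easy]; simpl in HT.
    set (K := 8 + 4 * (C 0 / m)).
    set (K' := 4 * (/ m) ^ 2 + 2 * alpha * C 0 * (/ m) ^ 4).
    assert (Him : 0 < / m) by (apply Rinv_0_lt_compat; lra).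
    assert (HK : 0 < K).
    { unfold K; assert (0 < C 0 / m) by (apply Rdiv_lt_0_compat; lra); lra. }
    assert (HK' : 0 < K').
    { unfold K'; pose proof (pow_lt _ 2 Him); pose proof (pow_lt _ 4 Him).
      assert (0 < 2 * alpha * C 0 * (/ m) ^ 4) by (repeat apply Rmult_lt_0_compat; lra).
      lra. }
    assert (HI0 : 0 < / C 0) by now apply Rinv_0_lt_compat.
    assert (HKT : 0 < / C 0 + K' * T)
      by (assert (0 < K' * T) by (now apply Rmult_lt_0_compat); lra).
    apply (Hleave m (A 0 + K * T) (/ (/ C 0 + K' * T)) (C 0)); [lra | |].
    { now apply Rinv_0_lt_compat. }
    intros t Ht HtT.
    assert (Hin : forall x, 0 <= x <= t -> Rbar_lt x T)
      by (intros x Hx; apply (Rbar_lt_below T x t); [lra | easy]).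
    simpl in HtT.
    assert (HAt : A t - A 0 <= K * (t - 0)).
    { apply mean_value_upper; [lra | |]; intros x Hx;
        destruct (Hsol x) as [HAx [HCx [HcA [_ Hd]]]]; try (apply Hin; lra); [easy |].
      exists (rg2_dA alpha (A x) (C x)); split; [apply Hd; lra |].
      apply rg2_dA_upper; try lra.
      - apply HmA; [lra | apply Hin; lra].
      - apply HCN; [lra | apply Hin; lra]. }
    assert (HCt : / C t - / C 0 <= K' * (t - 0)).
    { apply (flow_inverse_C_le alpha T A C); try easy; try lra.
      intros r Hr; apply HmA; [lra | now apply Hin]. }
    assert (0 < C t) by now apply (Hsol t).
    split; split.
    - apply HmA; [lra | easy].
    - assert (K * t <= K * T) by (apply Rmult_le_compat_l; lra); lra.
    - rewrite <- (Rinv_inv (C t)); apply Rinv_le_contravar;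
        [now apply Rinv_0_lt_compat |].
      assert (K' * t <= K' * T) by (apply Rmult_le_compat_l; lra); lra.
    - apply HCN; [lra | easy]. }
  subst T; split; [easy |].
  destruct (Classical_Prop.classic (exists t1, 0 <= t1 /\ 0 < cubic alpha (A t1) (C t1)))
    as [[t1 [Ht1 Hq]] | Hno].
  - assert (Hmono : forall s t, t1 <= s -> s <= t -> A s <= A t).
    { intros s t Hs Hst.
      apply (flow_positive_cubic_persists alpha p_infty A C); try easy; [lra |].
      now apply (flow_positive_cubic_persists alpha p_infty A C t1 s). }
    intros M; destruct (Classical_Prop.classic (exists t2, t1 <= t2 /\ M < A t2))
      as [[t2 [Ht2 HM]] | HM].
    + exists t2; split; [lra |]; intros t Ht; specialize (Hmono t2 t Ht2 Ht); lra.
    + exfalso; apply (no_bounded_immortal_flow alpha m M t1 A C); try easy.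
      intros t Ht; split; [apply HmA; [lra | easy] |].
      destruct (Rle_dec (A t) M) as [| Hlt]; [easy |].
      exfalso; apply HM; exists t; split; [easy | lra].
  - exfalso; apply (no_bounded_immortal_flow alpha m (A 0) 0 A C); try easy; try lra.
    intros t Ht; split; [now apply HmA |].
    apply (flow_A_antitone alpha p_infty A C); try easy; try lra.
    intros r Hr; destruct (Rle_dec (cubic alpha (A r) (C r)) 0) as [| Hlt]; [easy |].
    exfalso; apply Hno; exists r; split; lra.
Qed.

(** * Orbits below the separating solution *)

(** In the quotient (dA/dC) / A the factor A cancels, and what remains is
    bounded when C >= c; so ln A is bounded below by a Lipschitz function of
    C.  Concretely, ln A - K C is nondecreasing in time. *)
Lemma flow_A_positive_of_C_positive (alpha : R) (T : Rbar) (A C : R -> R) (c : R) :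
  0 < alpha -> Rbar_lt 0 T -> interior_solution alpha T A C -> 0 < c ->
  (forall t, 0 <= t -> Rbar_lt t T -> c <= C t <= C 0 /\ A t <= A 0) ->
  exists m, 0 < m /\ forall t, 0 <= t -> Rbar_lt t T -> m <= A t.
Proof.
  intros Ha HT Hsol Hc Hb.
  destruct (Hsol 0 HT) as [HA0 [HC0 _]].
  set (B := 8 * alpha * A 0 ^ 2 + 12 * alpha * A 0 * C 0 + 5 * alpha * C 0 ^ 2).
  assert (HB : 0 < B).
  { unfold B; pose proof (pow_lt _ 2 HA0); pose proof (pow_lt _ 2 HC0).
    assert (0 < alpha * A 0 ^ 2) by (now apply Rmult_lt_0_compat).
    assert (0 < alpha * C 0 ^ 2) by (now apply Rmult_lt_0_compat).
    assert (0 < alpha * A 0 * C 0) by (repeat apply Rmult_lt_0_compat; lra); lra. }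
  assert (Hac : 0 < alpha * c ^ 3)
    by (apply Rmult_lt_0_compat; [easy | now apply pow_lt]).
  set (K := B / (alpha * c ^ 3)).
  assert (HK : 0 < K) by now apply Rdiv_lt_0_compat.
  exists (exp (ln (A 0) - K * C 0)); split; [apply exp_pos |].
  intros t Ht HtT.
  assert (Hin : forall x, 0 <= x <= t -> Rbar_lt x T)
    by (intros x Hx; apply (Rbar_lt_below T x t); [lra | easy]).
  assert (HL : 0 * (t - 0) <= (ln (A t) - K * C t) - (ln (A 0) - K * C 0)).
  { apply (mean_value_lower (fun t => ln (A t) - K * C t)); [easy | |]; intros x Hx;
      destruct (Hsol x) as [HAx [HCx [HcA [HcC Hd]]]]; try (apply Hin; lra).
    - apply (continuous_minus (fun t => ln (A t)) (fun t => K * C t)).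
      + apply (continuous_comp A ln); [easy |].
        apply (ex_derive_continuous ln); auto_derive; easy.
      + now apply (continuous_mult (fun _ => K) C); [apply continuous_const |].
    - destruct Hd as [DA DC]; [lra |].
      exists (/ A x * rg2_dA alpha (A x) (C x) - K * rg2_dC alpha (A x) (C x)); split.
      + apply (is_derive_minus (fun t => ln (A t)) (fun t => K * C t)).
        * rewrite Rmult_comm.
          apply (is_derive_comp ln A); [now apply is_derive_ln | easy].
        * now apply (is_derive_scal C x K).
      + destruct (Hb x) as [[HcCx HCx0] HAx0]; [lra | apply Hin; lra |].
        replace (/ A x * rg2_dA alpha (A x) (C x) - K * rg2_dC alpha (A x) (C x))
          with (2 * (cubic alpha (A x) (C x)
                     + K * (C x ^ 2 * (2 * A x ^ 2 + alpha * C x))) * / (A x ^ 4))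
          by (rewrite rg2_dA_cubic by easy; unfold rg2_dC; field; lra).
        apply Rmult_le_pos; [| left; now apply Rinv_0_lt_compat, pow_lt].
        assert (E1 : K * (alpha * c ^ 3) = B) by (unfold K; field; lra).
        assert (E2 : alpha * c ^ 3 <= C x ^ 2 * (2 * A x ^ 2 + alpha * C x)).
        { replace (alpha * c ^ 3) with (c ^ 2 * (alpha * c)) by ring.
          pose proof (pow2_ge_0 (A x)).
          apply Rmult_le_compat; [apply pow2_ge_0 | nra | apply pow_incr; lra | nra]. }
        assert (E3 : B <= K * (C x ^ 2 * (2 * A x ^ 2 + alpha * C x)))
          by (rewrite <- E1; apply Rmult_le_compat_l; lra).
        enough (- B <= cubic alpha (A x) (C x)) by lra.
        unfold B, cubic.
        assert (A x ^ 2 <= A 0 ^ 2) by (apply pow_incr; lra).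
        assert (C x ^ 2 <= C 0 ^ 2) by (apply pow_incr; lra).
        assert (A x * C x <= A 0 * C 0) by (apply Rmult_le_compat; lra).
        assert (alpha * A x ^ 2 <= alpha * A 0 ^ 2) by (apply Rmult_le_compat_l; lra).
        assert (alpha * C x ^ 2 <= alpha * C 0 ^ 2) by (apply Rmult_le_compat_l; lra).
        assert (alpha * (A x * C x) <= alpha * (A 0 * C 0))
          by (apply Rmult_le_compat_l; lra).
        pose proof (pow_lt _ 3 HAx).
        assert (0 < A x ^ 2 * C x)
          by (apply Rmult_lt_0_compat; [now apply pow_lt | easy]).
        lra. }
  destruct (Hsol t HtT) as [HAt [HCt _]].
  rewrite <- (exp_ln (A t)) by easy.
  assert (HKC : 0 <= K * C t) by (apply Rmult_le_pos; lra).
  destruct (Req_dec (ln (A 0) - K * C 0) (ln (A t))) as [-> |]; [lra |].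
  left; apply exp_increasing; lra.
Qed.

(** For A <= A1 < 2 alpha the terms 4A^3 - 8 alpha A^2 already dominate, and
    the terms with C are nonpositive. *)
Lemma rg2_dA_upper_below_2alpha (alpha A C A1 : R) :
  0 < alpha -> 0 < A -> A <= A1 -> A1 < 2 * alpha -> 0 < C ->
  rg2_dA alpha A C <= - (8 * (2 * alpha - A1) / A1).
Proof.
  intros Ha HA HA1 H1 HC; rewrite rg2_dA_cubic by easy.
  assert (HA2 : 0 < A ^ 2) by now apply pow_lt.
  assert (Hq : cubic alpha A C <= - (4 * A ^ 2 * (2 * alpha - A1))).
  { unfold cubic.
    assert (0 < A * C) by (now apply Rmult_lt_0_compat).
    assert (0 <= A * C * (6 * alpha - A)) by (apply Rmult_le_pos; lra).
    assert (0 <= A ^ 2 * (A1 - A)) by (apply Rmult_le_pos; lra).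
    assert (0 < alpha * C ^ 2) by (apply Rmult_lt_0_compat; [easy | now apply pow_lt]).
    nra. }
  apply Rle_trans with (2 * - (4 * A ^ 2 * (2 * alpha - A1)) / A ^ 3).
  - apply Rmult_le_compat_r; [left; now apply Rinv_0_lt_compat, pow_lt | lra].
  - replace (2 * - (4 * A ^ 2 * (2 * alpha - A1)) / A ^ 3)
      with (- (8 * (2 * alpha - A1) / A)) by (field; lra).
    apply Ropp_le_contravar, Rmult_le_compat_l; [lra |].
    now apply Rinv_le_contravar.
Qed.

Lemma flow_below_2alpha_finite_time (alpha : R) (T : Rbar) (A C : R -> R) (t0 A1 : R) :
  0 < alpha -> interior_solution alpha T A C -> 0 <= t0 -> Rbar_lt t0 T ->
  A1 < 2 * alpha -> (forall t, t0 <= t -> Rbar_lt t T -> A t <= A1) ->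
  T <> p_infty.
Proof.
  intros Ha Hsol Ht0 Ht0T HA1 HA ->.
  destruct (Hsol t0 I) as [HA0 _].
  assert (H01 : A t0 <= A1) by (apply HA; [lra | easy]).
  set (k := 8 * (2 * alpha - A1) / A1).
  assert (Hk : 0 < k) by (apply Rdiv_lt_0_compat; lra).
  set (t1 := t0 + A1 / k).
  assert (Ht1 : t0 < t1).
  { unfold t1; enough (0 < A1 / k) by lra; apply Rdiv_lt_0_compat; lra. }
  destruct (Hsol t1 I) as [HAt1 _].
  assert (H : A t1 - A t0 <= - k * (t1 - t0)).
  { apply mean_value_upper; [lra | |]; intros x Hx;
      destruct (Hsol x I) as [HAx [HCx [HcA [_ Hd]]]]; [easy |].
    exists (rg2_dA alpha (A x) (C x)); split; [apply Hd; lra |].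
    apply rg2_dA_upper_below_2alpha; try easy; apply HA; [lra | easy]. }
  replace (- k * (t1 - t0)) with (- A1) in H by (unfold t1; field; lra).
  lra.
Qed.

Lemma tends_left_eventually_near (T : Rbar) (f : R -> R) (l e : R) :
  tends_left T f l -> 0 < e -> exists t0, 0 <= t0 /\ Rbar_lt t0 T /\
    forall t, t0 <= t -> Rbar_lt t T -> l - e < f t < l + e.
Proof.
  intros Hf He; destruct (Hf e He) as [t0 [H0 [H1 H2]]].
  exists t0; split; [easy | split; [easy |]]; intros t Ht HtT.
  specialize (H2 t Ht HtT); apply Rabs_lt_between in H2; lra.
Qed.

(** The limits a of A and c of C exist by monotonicity.  The possible pairs
    are cut down in turn: c = 0, then a <= 2 alpha, then a = 2 alpha or
    a = 0, the last one in finite time. *)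
Lemma flow_below_separatrix (alpha : R) (T : Rbar) (A C : R -> R) :
  0 < alpha -> Rbar_lt 0 T -> interior_solution alpha T A C -> leaves_boxes T A C ->
  (forall t, 0 <= t -> Rbar_lt t T -> cubic alpha (A t) (C t) <= 0) ->
  tends_left T C 0 /\
  ((T <> p_infty /\ tends_left T A 0) \/ tends_left T A (2 * alpha)).
Proof.
  intros Ha HT Hsol Hleave Hq.
  assert (HmA : forall s t, 0 <= s -> s <= t -> Rbar_lt t T -> A t <= A s).
  { intros s t Hs Hst Ht; apply (flow_A_antitone alpha T A C); try easy.
    intros r Hr; apply Hq; [lra |]; apply (Rbar_lt_below T r t); [lra | easy]. }
  assert (HmC : forall s t, 0 <= s -> s <= t -> Rbar_lt t T -> C t <= C s)
    by (intros s t Hs Hst Ht; now apply (flow_C_antitone alpha T A C)).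
  destruct (antitone_limit T A) as [a [Ha0 [HaA HlA]]]; try easy.
  { intros t Ht HtT; left; now apply (Hsol t). }
  destruct (antitone_limit T C) as [c [Hc0 [HcC HlC]]]; try easy.
  { intros t Ht HtT; left; now apply (Hsol t). }
  destruct (Hsol 0 HT) as [HA0 [HC0 _]].
  assert (Ec : c = 0).
  { destruct Hc0 as [Hc | <-]; [exfalso | easy].
    destruct (flow_A_positive_of_C_positive alpha T A C c) as [m [Hm HAm]]; try easy.
    { intros t Ht HtT; split; [split; [now apply HcC |] |];
        [apply HmC | apply HmA]; easy || lra. }
    assert (ET : T = p_infty).
    { apply (Hleave m (A 0) c (C 0)); [easy | easy |].
      intros t Ht HtT; split; split.
      - apply HAm; [lra | easy].
      - apply HmA; [lra | lra | easy].
      - apply HcC; [lra | easy].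
      - apply HmC; [lra | lra | easy]. }
    subst T.
    set (t := A 0 ^ 2 / (4 * c)).
    assert (Ht : 0 < t) by (apply Rdiv_lt_0_compat; [now apply pow_lt | lra]).
    assert (HI : 4 * (/ A 0) ^ 2 * (t - 0) <= / C t - / C 0).
    { apply (flow_inverse_C_ge alpha p_infty A C); try easy; [lra |].
      intros r Hr; apply HmA; easy || lra. }
    replace (4 * (/ A 0) ^ 2 * (t - 0)) with (/ c) in HI by (unfold t; field; lra).
    assert (/ C t <= / c) by (apply Rinv_le_contravar; [easy | apply HcC; [lra | easy]]).
    assert (0 < / C 0) by now apply Rinv_0_lt_compat.
    lra. }
  subst c; split; [easy |].
  assert (Ha2 : a <= 2 * alpha).
  { destruct (Rle_dec a (2 * alpha)) as [| Hgt]; [easy | exfalso].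
    set (S := 12 * alpha * A 0 + 5 * alpha * C 0).
    assert (HS : 0 < S).
    { unfold S; assert (0 < alpha * A 0) by (now apply Rmult_lt_0_compat).
      assert (0 < alpha * C 0) by (now apply Rmult_lt_0_compat); lra. }
    assert (Hgap : 0 < 4 * a ^ 2 * (a - 2 * alpha)).
    { apply Rmult_lt_0_compat; [| lra].
      assert (0 < a ^ 2) by (apply pow_lt; lra); lra. }
    destruct (tends_left_eventually_near T C 0 (4 * a ^ 2 * (a - 2 * alpha) / S) HlC)
      as [t [Ht [HtT Hnear]]]; [now apply Rdiv_lt_0_compat |].
    specialize (Hnear t (Rle_refl t) HtT); specialize (Hq t Ht HtT).
    destruct (Hsol t HtT) as [HAt [HCt _]]; specialize (HaA t Ht HtT).
    assert (HSC : C t * S < 4 * a ^ 2 * (a - 2 * alpha)).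
    { replace (4 * a ^ 2 * (a - 2 * alpha))
        with (4 * a ^ 2 * (a - 2 * alpha) / S * S) by (field; lra).
      apply Rmult_lt_compat_r; lra. }
    assert (4 * a ^ 2 * (a - 2 * alpha) <= 4 * A t ^ 2 * (A t - 2 * alpha)).
    { assert (a ^ 2 <= A t ^ 2) by (apply pow_incr; lra).
      pose proof (pow2_ge_0 a).
      apply Rmult_le_compat; lra. }
    assert (alpha * A t * C t <= alpha * A 0 * C t).
    { apply Rmult_le_compat_r; [lra |]; apply Rmult_le_compat_l; [lra |].
      apply HmA; easy || lra. }
    assert (alpha * C t * C t <= alpha * C 0 * C t).
    { apply Rmult_le_compat_r; [lra |]; apply Rmult_le_compat_l; [lra |].
      apply HmC; easy || lra. }
    assert (0 < A t ^ 2 * C t) by (apply Rmult_lt_0_compat; [now apply pow_lt | easy]).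
    unfold cubic in Hq; unfold S in HSC; lra. }
  destruct Ha2 as [Ha2 | ->]; [left | now right].
  set (A1 := (a + 2 * alpha) / 2).
  destruct (tends_left_eventually_near T A a (A1 - a) HlA) as [t0 [Ht0 [Ht0T Hnear]]];
    [unfold A1; lra |].
  assert (HTfin : T <> p_infty).
  { apply (flow_below_2alpha_finite_time alpha T A C t0 A1); try easy; [unfold A1; lra |].
    intros t Ht HtT; specialize (Hnear t Ht HtT); lra. }
  split; [easy |].
  destruct Ha0 as [Hap | <-]; [exfalso | easy].
  destruct T as [T | |]; [| easy | easy]; simpl in HT.
  (* 1/C stays bounded on a finite time interval where A is bounded away from 0 *)
  set (K := 4 * (/ a) ^ 2 + 2 * alpha * C 0 * (/ a) ^ 4).
  assert (Hia : 0 < / a) by now apply Rinv_0_lt_compat.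
  assert (HK : 0 < K).
  { unfold K; pose proof (pow_lt _ 2 Hia); pose proof (pow_lt _ 4 Hia).
    assert (0 < 2 * alpha * C 0 * (/ a) ^ 4) by (repeat apply Rmult_lt_0_compat; lra).
    lra. }
  assert (HI0 : 0 < / C 0) by now apply Rinv_0_lt_compat.
  assert (HKT : 0 < / C 0 + K * T)
    by (assert (0 < K * T) by (now apply Rmult_lt_0_compat); lra).
  destruct (tends_left_eventually_near T C 0 (/ (/ C 0 + K * T)) HlC)
    as [t [Ht [HtT HnC]]]; [now apply Rinv_0_lt_compat |].
  specialize (HnC t (Rle_refl t) HtT).
  destruct (Hsol t HtT) as [_ [HCt _]].
  assert (HI : / C t - / C 0 <= K * (t - 0)).
  { apply (flow_inverse_C_le alpha T A C); try easy; try lra.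
    intros r Hr; apply HaA; [lra |]; apply (Rbar_lt_below T r t); [lra | easy]. }
  simpl in HtT.
  assert (K * t <= K * T) by (apply Rmult_le_compat_l; lra).
  assert (/ (/ (/ C 0 + K * T)) < / C t).
  { apply Rinv_lt_contravar; [| lra].
    apply Rmult_lt_0_compat; [easy | now apply Rinv_0_lt_compat]. }
  rewrite Rinv_inv in H0; lra.
Qed.

(** * The dichotomy *)
Lemma filterlim_of_tends_left (T : Rbar) (A C : R -> R) (a c : R) :
  Rbar_lt 0 T ->
  tends_left T (fun t => A (Rmax 0 t)) a -> tends_left T (fun t => C (Rmax 0 t)) c ->
  filterlim (fun t => (C t, A t)) (Rbar_at_left T) (locally (c, a)).
Proof.
  intros HT HA HC.
  assert (Hev : forall (f : R -> R) l e, tends_left T (fun t => f (Rmax 0 t)) l -> 0 < e ->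
      Rbar_at_left T (fun t => Rabs (f t - l) < e)).
  { intros f l e Hf He; destruct (Hf e He) as [t0 [H0 [H1 H2]]].
    assert (Hin : forall t, t0 < t -> Rbar_lt t T -> Rabs (f t - l) < e).
    { intros t Ht HtT; rewrite <- (Rmax_right 0 t) by lra; apply H2; [lra | easy]. }
    unfold Rbar_at_left, within; destruct T as [T | |]; [| | easy].
    - apply (filter_imp (fun t => t0 < t)); [exact Hin | now apply open_gt].
    - now exists t0. }
  intros P [e He].
  assert (FF : Filter (Rbar_at_left T)) by apply within_filter, Rbar_locally_filter.
  generalize (filter_and _ _ (Hev C c e HC (cond_pos e)) (Hev A a e HA (cond_pos e))).
  unfold filtermap; apply filter_imp; intros t Ht; now apply He.
Qed.

Theorem theorem10 (alpha : R) (halpha : 0 < alpha)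
    (phi : R -> R) (hphi : separating_solution alpha phi)
    (A C : R -> R) (tmax : Rbar) (C0 A0 : R)
    (hC0 : 0 < C0) (hA0 : 0 < A0)
    (hinitC : C 0 = C0) (hinitA : A 0 = A0)
    (hsol : rg2_maximal_solution alpha tmax A C) :
  (phi C0 < A0 ->
     tmax = p_infty /\
     is_lim A p_infty p_infty /\
     exists Cbar : R, 0 <= Cbar /\ is_lim C p_infty (Finite Cbar))
  /\
  (A0 <= phi C0 ->
     (Rbar_lt tmax p_infty /\
      filterlim (fun t => (C t, A t)) (Rbar_at_left tmax) (locally (0, 0)))
     \/
     filterlim (fun t => (C t, A t)) (Rbar_at_left tmax)
       (locally (0, 2 * alpha))).
Proof.
  destruct hphi as [g [phin [Hg [Hphin Hlim]]]].
  pose proof hsol as [HT [Hsol _]].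
  set (A' := fun t => A (Rmax 0 t)); set (C' := fun t => C (Rmax 0 t)).
  assert (Hflow : interior_solution alpha tmax A' C')
    by now apply interior_solution_clamped.
  assert (E0 : A' 0 = A0 /\ C' 0 = C0).
  { unfold A', C'; now rewrite Rmax_left by lra. }
  destruct E0 as [EA EC].
  assert (Eid : forall t, 0 <= t -> A' t = A t /\ C' t = C t).
  { intros t Ht; unfold A', C'; now rewrite Rmax_right. }
  assert (Hleave : leaves_boxes tmax A' C').
  { intros p1 q1 p2 q2 H1 H2 Hbox; destruct tmax as [T | |]; [exfalso | easy | easy].
    apply (maximal_solution_leaves_boxes alpha T A C p1 q1 p2 q2); try easy.
    intros t Ht; destruct (Eid t) as [<- <-]; [lra | now apply Hbox]. }
  split.
  - intros Habove.
    destruct (inv_INR_eventually C0 hC0) as [N [HN1 HN]].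
    assert (Hev : eventually (fun n => phin n C0 < A0)).
    { apply (Hlim C0 hC0 (fun x => x < A0)); now apply open_lt. }
    destruct Hev as [N' HN'].
    set (n := max N N').
    assert (Hn : (1 <= n)%nat) by lia.
    destruct (flow_above_separatrix alpha tmax A' C' g (phin n) n) as [ET HA]; try easy.
    + now apply Hphin.
    + rewrite EC; left; apply HN; lia.
    + rewrite EA, EC; apply HN'; lia.
    + split; [easy |]; subst tmax; split.
      * apply is_lim_spec; intros M; destruct (HA M) as [t1 [Ht1 HM]].
        exists t1; intros t Ht; destruct (Eid t) as [<- _]; [lra | apply HM; lra].
      * destruct (antitone_limit p_infty C') as [c [Hc [_ HlC]]]; try easy.
        { intros s t Hs Hst Ht; now apply (flow_C_antitone alpha p_infty A' C'). }
        { intros t Ht HtT; left; now apply (Hflow t). }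
        exists c; split; [easy |]; apply is_lim_spec; intros e.
        destruct (HlC e (cond_pos e)) as [t0 [Ht0 [_ H]]].
        exists t0; intros t Ht; destruct (Eid t) as [_ <-]; [lra | apply H; [lra | easy]].
  - intros Hbelow.
    assert (Hq : forall t, 0 <= t -> Rbar_lt t tmax -> cubic alpha (A' t) (C' t) <= 0).
    { intros t Ht HtT; destruct (Hflow t HtT) as [HAt [HCt _]].
      destruct (inv_INR_eventually (C' t) HCt) as [n [Hn1 Hn]].
      specialize (Hn n (Nat.le_refl n)).
      assert (HC' : C' t <= C' 0)
        by (apply (flow_C_antitone alpha tmax A' C'); try easy; lra).
      destruct (nullcline_trajectory_global alpha g n (phin n)) as [Sy [_ By]]; try easy.
      { now apply Hphin. }
      destruct (flow_trajectory_noncrossing alpha tmax A' C' (phin n) (/ INR n) t)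
        as [_ Hcr]; try easy; [lra |].
      assert (Hphi : phi C0 <= phin n C0).
      { apply (separating_solution_below alpha g phi phin); try easy; [| lra].
        now apply Hlim. }
      destruct (Rle_dec (cubic alpha (A' t) (C' t)) 0) as [| Hpos]; [easy | exfalso].
      enough (phin n (C' 0) < A' 0) by (rewrite EA, EC in *; lra).
      apply Hcr; destruct (Rlt_dec (phin n (C' t)) (A' t)) as [| Hle]; [easy | exfalso].
      destruct (By (C' t)) as [Hneg _]; [lra |].
      enough (0 < cubic alpha (phin n (C' t)) (C' t)) by lra.
      apply (cubic_positive_mono alpha (A' t) (C' t)); lra. }
    destruct (flow_below_separatrix alpha tmax A' C') as [HlC [[Hfin HlA] | HlA]]; try easy.
    + left; split; [destruct tmax; easy | now apply filterlim_of_tends_left].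
    + right; now apply filterlim_of_tends_left.
Qed.
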